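(* Let $\Omega$ be the Fraïssé limit of the class $\mathfrak{P}$ of finite posets (the universal homogeneous countable partial order), let $G=\mathrm{Aut}(\Omega)$, and let $k$ be a field of characteristic $0$. Then measures for $G$ valued in $k$ are naturally in bijection with measures for $\mathfrak{P}$ valued in $k$.
   Context: An embedding of posets is an injective map $\alpha\colon P\to Q$ with $x\le y\iff\alpha(x)\le\alpha(y)$. $\Omega$ is the unique (up to isomorphism) countable poset into which exactly the finite posets embed (among finite structures with one binary relation) and which is homogeneous: any two embeddings of the same finite poset into $\Omega$ differ by an automorphism of $\Omega$. Measures for $\mathfrak{P}$: given embeddings $\alpha\colon P\to Q$ and $\beta\colon P\to P'$ of finite posets, an amalgamation is a triple $(Q',\alpha',\beta')$ where $Q'$ is a poset and $\alpha'\colon P'\to Q'$, $\beta'\colon Q\to Q'$ are embeddings with $\beta'\circ\alpha=\alpha'\circ\beta$ and $Q'=\mathrm{im}(\alpha')\cup\mathrm{im}(\beta')$, considered up to isomorphism. A measure for $\mathfrak{P}$ valued in $k$ is a rule $\nu$ assigning to each embedding $\alpha$ of finite posets a value $\nu(\alpha)\in k$ such that (a) $\nu(\alpha)=1$ if $\alpha$ is an isomorphism; (b) $\nu(\beta\circ\alpha)=\nu(\beta)\nu(\alpha)$; (c) for $\alpha\colon P\to Q$, $\beta\colon P\to P'$ with amalgamations $(Q'_i,\alpha'_i,\beta'_i)$, $1\le i\le r$, up to isomorphism, $\nu(\alpha)=\sum_i\nu(\alpha'_i)$. Measures for $G$: for finite $A\subset\Omega$ let $G(A)$ be the pointwise stabilizer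 of $A$; these form a neighborhood basis of the identity of a topology on $G$. A $G$-set is a set with an action of $G$ having finitely many orbits and such that all stabilizers are open. A measure for $G$ valued in $k$ is a rule $\mu$ assigning to each $G$-equivariant map $f\colon Y\to X$ of transitive $G$-sets a value $\mu(f)\in k$ such that (a) $\mu(f)=1$ if $f$ is an isomorphism; (b) $\mu(g\circ f)=\mu(g)\mu(f)$ when defined; (c) if $f\colon Y\to X$ and $X'\to X$ are maps of transitive $G$-sets, $Y'_1,\dots,Y'_r$ are the $G$-orbits on $X'\times_XY$, and $f'_i\colon Y'_i\to X'$ are the projections, then $\mu(f)=\sum_{i=1}^r\mu(f'_i)$. The natural correspondence: for a finite poset $P$ let $\Omega^{[P]}$ be the set of embeddings $P\to\Omega$, a transitive $G$-set; an embedding $\alpha\colon P\to Q$ induces by restriction a $G$-map $\alpha^*\colon\Omega^{[Q]}\to\Omega^{[P]}$. A measure $\mu$ for $G$ is sent to the measure $\alpha\mapsto\mu(\alpha^* )$ for $\mathfrak{P}$. *)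

(* Defs.v *)
From HB Require Import structures.
From mathcomp Require Import all_boot all_order all_algebra.
From mathcomp Require Import boolp classical_sets functions cardinality.
From mathcomp Require Import topology.

Set Implicit Arguments.
Unset Strict Implicit.
Unset Printing Implicit Defensive.

Import Order.TTheory GRing.Theory.

Local Open Scope classical_set_scope.
Local Open Scope group_scope.

(* Rules such as measures live on these records; by proof irrelevance two
   embeddings (automorphisms, equivariant maps) with the same underlying
   function are equal. *)
Record embedding (d : Order.disp_t) (P Q : porderType d) := Embedding {
  emb_fun :> P -> Q;
  emb_inj : injective emb_fun;
  emb_mono : {mono emb_fun : x y / (x <= y)%O}
}.

Lemma emb_eq (d : Order.disp_t) (P Q : porderType d) (a b : embedding P Q) :
  a =1 b -> a = b.
Proof.
case: a b => [a ai am] [b bi bm] /= /funext ab; subst b.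
by congr Embedding; exact: Prop_irrelevance.
Qed.

Lemma emb_comp_mono (d : Order.disp_t) (P Q R : porderType d)
    (b : embedding Q R) (a : embedding P Q) :
  {mono (b \o a) : x y / (x <= y)%O}.
Proof. by move=> x y /=; rewrite !emb_mono. Qed.

Definition emb_comp (d : Order.disp_t) (P Q R : porderType d)
    (b : embedding Q R) (a : embedding P Q) : embedding P R :=
  Embedding (inj_comp (@emb_inj _ _ _ b) (@emb_inj _ _ _ a))
    (emb_comp_mono b a).

Record aut (d : Order.disp_t) (Omega : porderType d) := Aut {
  aut_fun :> Omega -> Omega;
  aut_inv : Omega -> Omega;
  aut_funK : cancel aut_fun aut_inv;
  aut_invK : cancel aut_inv aut_fun;
  aut_mono : {mono aut_fun : x y / (x <= y)%O}
}.

Section AutGroup.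
Context (d : Order.disp_t) (Omega : porderType d).
Implicit Types g h : aut Omega.

Lemma aut_eq g h : g =1 h -> g = h.
Proof.
case: g h => [f i fK iK m] [f' i' fK' iK' m'] /= /funext ff'; subst f'.
have ii' : i = i' by apply/funext => x; rewrite -{1}(iK' x) fK.
by subst i'; congr Aut; exact: Prop_irrelevance.
Qed.

Definition aut_one : aut Omega :=
  @Aut d Omega id id (fun=> erefl) (fun=> erefl) (fun _ _ => erefl).

Lemma aut_inv_mono g : {mono aut_inv g : x y / (x <= y)%O}.
Proof. by move=> x y; rewrite -(aut_mono g) !aut_invK. Qed.

Definition aut_invg g : aut Omega :=
  Aut (@aut_invK _ _ g) (@aut_funK _ _ g) (aut_inv_mono g).

Lemma aut_comp_mono g h : {mono (g \o h) : x y / (x <= y)%O}.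
Proof. by move=> x y /=; rewrite !aut_mono. Qed.

Definition aut_mul g h : aut Omega :=
  Aut (can_comp (@aut_funK _ _ g) (@aut_funK _ _ h))
    (can_comp (@aut_invK _ _ h) (@aut_invK _ _ g)) (aut_comp_mono g h).

Lemma aut_mulA : associative aut_mul.
Proof. by move=> g h k; exact: aut_eq. Qed.

Lemma aut_mul1 : left_id aut_one aut_mul.
Proof. by move=> g; exact: aut_eq. Qed.

Lemma aut_mulr1 : right_id aut_one aut_mul.
Proof. by move=> g; exact: aut_eq. Qed.

Lemma aut_mulV : left_inverse aut_one aut_invg aut_mul.
Proof. by move=> g; apply: aut_eq => x /=; rewrite aut_funK. Qed.

Lemma aut_mulVr : right_inverse aut_one aut_invg aut_mul.
Proof. by move=> g; apply: aut_eq => x /=; rewrite aut_invK. Qed.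

HB.instance Definition _ := gen_eqMixin (aut Omega).
HB.instance Definition _ := gen_choiceMixin (aut Omega).
HB.instance Definition _ := isGroup.Build (aut Omega)
  aut_mulA aut_mul1 aut_mulr1 aut_mulV aut_mulVr.

Definition fixer (A : set Omega) : set (aut Omega) :=
  [set g | forall a, A a -> g a = a].

Definition aut_open (U : set (aut Omega)) : Prop :=
  forall g, U g -> exists2 A : set Omega, finite_set A &
    [set g * h | h in fixer A] `<=` U.

Lemma aut_openT : aut_open setT.
Proof. by move=> g _; exists set0. Qed.

Lemma aut_openI : setI_closed aut_open.
Proof.
move=> U V oU oV g [/oU[A fA AU] /oV[B fB BV]].
exists (A `|` B); first by rewrite finite_setU.
move=> _ [h hAB <-]; split.
- by apply: AU; exists h => // a Aa; apply: hAB; left.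
- by apply: BV; exists h => // a Ba; apply: hAB; right.
Qed.

Lemma aut_open_bigU (I : Type) (f : I -> set (aut Omega)) :
  (forall i, aut_open (f i)) -> aut_open (\bigcup_i f i).
Proof.
move=> of_ g [i _ /of_[A fA Af]]; exists A => //.
by move=> x /Af fx; exists i.
Qed.

HB.instance Definition _ := isOpenTopological.Build (aut Omega)
  aut_openT aut_openI aut_open_bigU.

Lemma aut_openE (U : set (aut Omega)) : open U = aut_open U.
Proof. by []. Qed.

End AutGroup.

Lemma sval_eq (T : Type) (P : T -> Prop) (x y : {t | P t}) :
  sval x = sval y -> x = y.
Proof. by case: x y => [x Px] [y Py] /= xy; exact: eq_exist. Qed.

Section GSets.
Context (d : Order.disp_t) (Omega : porderType d).

Record gaction := GAction {
  gcarrier :> Type;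
  gact : aut Omega -> gcarrier -> gcarrier;
  gact1 : forall x, gact 1 x = x;
  gactM : forall g h x, gact (g * h) x = gact g (gact h x)
}.

Definition stabilizer (X : gaction) (x : X) : set (aut Omega) :=
  [set g | gact g x = x].

Definition smooth (X : gaction) : Prop := forall x : X, open (stabilizer x).

Definition in_orbit (X : gaction) (x y : X) : Prop := exists g, gact g x = y.

Definition transitive_action (X : gaction) : Prop :=
  exists x : X, forall y, in_orbit x y.

Record tgset := TGSet {
  tgset_action :> gaction;
  tgset_trans : transitive_action tgset_action;
  tgset_smooth : smooth tgset_action
}.

Record gmap (Y X : gaction) := GMap {
  gmap_fun :> Y -> X;
  gmap_equiv : forall g y, gmap_fun (gact g y) = gact g (gmap_fun y)
}.

Lemma gmap_eq (Y X : gaction) (f f' : gmap Y X) : f =1 f' -> f = f'.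
Proof.
case: f f' => [f fe] [f' f'e] /= /funext ff'; subst f'.
by congr GMap; exact: Prop_irrelevance.
Qed.

Lemma gmap_comp_equiv (Z Y X : gaction) (f : gmap Y X) (f' : gmap Z Y) g z :
  (f \o f') (gact g z) = gact g ((f \o f') z).
Proof. by rewrite /= !gmap_equiv. Qed.

Definition gmap_comp (Z Y X : gaction) (f : gmap Y X) (f' : gmap Z Y) :
  gmap Z X := GMap (gmap_comp_equiv f f').

Section FiberProduct.
Context (X' Y X : gaction) (h : gmap X' X) (f : gmap Y X).

Definition fiber_carrier := {p : X' * Y | h p.1 = f p.2}.

Lemma fiber_act_subproof (g : aut Omega) (p : fiber_carrier) :
  h (gact g (sval p).1) = f (gact g (sval p).2).
Proof. by rewrite !gmap_equiv (svalP p). Qed.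

Definition fiber_act (g : aut Omega) (p : fiber_carrier) : fiber_carrier :=
  exist (fun p : X' * Y => h p.1 = f p.2)
    (gact g (sval p).1, gact g (sval p).2) (fiber_act_subproof g p).

Lemma fiber_act1 p : fiber_act 1 p = p.
Proof. by apply: sval_eq; rewrite /= !gact1; case: (sval p). Qed.

Lemma fiber_actM g g' p :
  fiber_act (g * g') p = fiber_act g (fiber_act g' p).
Proof. by apply: sval_eq; rewrite /= !gactM. Qed.

Definition fiber_product : gaction := GAction fiber_act1 fiber_actM.

Lemma fiber_product_smooth : smooth X' -> smooth Y -> smooth fiber_product.
Proof.
move=> sX' sY p.
suff -> : stabilizer p = stabilizer (sval p).1 `&` stabilizer (sval p).2.
  exact: openI.
apply/seteqP; split=> [g /(congr1 sval) /= E|g [E1 E2]].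
  by split; rewrite /stabilizer /= -[in RHS]E.
by apply: sval_eq; rewrite /= E1 E2; case: (sval p).
Qed.

End FiberProduct.

Section Orbit.
Context (Z : gaction) (z : Z).

Definition orbit_carrier := {w : Z | in_orbit z w}.

Lemma orbit_act_subproof (g : aut Omega) (w : orbit_carrier) :
  in_orbit z (gact g (sval w)).
Proof. by case: w => w [h hw] /=; exists (g * h); rewrite gactM hw. Qed.

Definition orbit_act (g : aut Omega) (w : orbit_carrier) : orbit_carrier :=
  exist (in_orbit z) (gact g (sval w)) (orbit_act_subproof g w).

Lemma orbit_act1 w : orbit_act 1 w = w.
Proof. by apply: sval_eq; rewrite /= gact1. Qed.

Lemma orbit_actM g h w : orbit_act (g * h) w = orbit_act g (orbit_act h w).
Proof. by apply: sval_eq; rewrite /= gactM. Qed.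

Definition orbit_action : gaction := GAction orbit_act1 orbit_actM.

Lemma orbit_trans : transitive_action orbit_action.
Proof.
have zz : in_orbit z z by exists 1; rewrite gact1.
exists (exist (in_orbit z) z zz : orbit_action) => -[w [g gw]].
by exists g; apply: sval_eq.
Qed.

Lemma orbit_smooth : smooth Z -> smooth orbit_action.
Proof.
move=> sZ w; suff -> : stabilizer w = stabilizer (sval w) by exact: sZ.
by apply/seteqP; split=> [g /(congr1 sval)|g gw] //; apply: sval_eq.
Qed.

Definition orbit_tgset (sZ : smooth Z) : tgset :=
  TGSet orbit_trans (orbit_smooth sZ).

End Orbit.

Section FiberOrbits.
Context (X' Y X : tgset) (h : gmap X' X) (f : gmap Y X).

Definition fiber_orbit (z : fiber_product h f) : tgset :=
  orbit_tgset z
    (fiber_product_smooth (@tgset_smooth X') (@tgset_smooth Y)).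

Definition fiber_orbit_proj (z : fiber_product h f) : gmap (fiber_orbit z) X' :=
  @GMap (fiber_orbit z) X' (fun w => (sval (sval w)).1) (fun _ _ => erefl).

End FiberOrbits.

Definition grule (k : fieldType) : Type :=
  forall Y X : tgset, gmap Y X -> k.

(* In the third field, z lists one representative of each orbit on the fiber
   product; there are only finitely many orbits when Omega is the generic
   poset, so such a list exists for all h and f. *)
Record is_gmeasure (k : fieldType) (mu : grule k) : Prop := IsGMeasure {
  gmeasure_iso : forall (Y X : tgset) (f : gmap Y X),
    bijective f -> mu Y X f = 1%R;
  gmeasure_comp : forall (Z Y X : tgset) (g : gmap Y X) (f : gmap Z Y),
    mu Z X (gmap_comp g f) = (mu Y X g * mu Z Y f)%R;
  gmeasure_orbits : forall (X' Y X : tgset) (f : gmap Y X) (h : gmap X' X)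
      (r : nat) (z : 'I_r -> fiber_product h f),
    (forall w, exists! i, in_orbit (z i) w) ->
    mu Y X f = (\sum_(i < r) mu _ X' (fiber_orbit_proj (z i)))%R
}.

End GSets.

Record amalgamation (d : Order.disp_t) (P Q P' : finPOrderType d)
    (alpha : embedding P Q) (beta : embedding P P') := Amalgamation {
  amalg_obj : finPOrderType d;
  amalg_alpha : embedding P' amalg_obj;
  amalg_beta : embedding Q amalg_obj;
  amalg_comm : amalg_beta \o alpha =1 amalg_alpha \o beta;
  amalg_cover : forall z, (exists y, amalg_alpha y = z) \/
                          (exists y, amalg_beta y = z)
}.

Definition amalg_iso (d : Order.disp_t) (P Q P' : finPOrderType d)
    (alpha : embedding P Q) (beta : embedding P P')
    (A B : amalgamation alpha beta) : Prop :=
  exists phi : embedding (amalg_obj A) (amalg_obj B),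
    [/\ bijective phi,
        phi \o amalg_alpha A =1 amalg_alpha B &
        phi \o amalg_beta A =1 amalg_beta B].

Definition prule (d : Order.disp_t) (k : fieldType) : Type :=
  forall P Q : finPOrderType d, embedding P Q -> k.

(* In the third field, A lists one representative of each isomorphism class of
   amalgamations; there are only finitely many classes, so such a list exists
   for all alpha and beta. *)
Record is_pmeasure (d : Order.disp_t) (k : fieldType) (nu : prule d k) : Prop :=
  IsPMeasure {
  pmeasure_iso : forall (P Q : finPOrderType d) (alpha : embedding P Q),
    bijective alpha -> nu P Q alpha = 1%R;
  pmeasure_comp : forall (P Q R : finPOrderType d)
      (beta : embedding Q R) (alpha : embedding P Q),
    nu P R (emb_comp beta alpha) = (nu Q R beta * nu P Q alpha)%R;
  pmeasure_amalg : forall (P Q P' : finPOrderType d)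
      (alpha : embedding P Q) (beta : embedding P P')
      (r : nat) (A : 'I_r -> amalgamation alpha beta),
    (forall B, exists! i, amalg_iso (A i) B) ->
    nu P Q alpha = (\sum_(i < r) nu P' _ (amalg_alpha (A i)))%R
}.

Record generic_poset (d : Order.disp_t) (Omega : porderType d) : Prop :=
  GenericPoset {
  generic_countable : countable [set: Omega];
  generic_age : forall (T : finType) (r : rel T),
    (exists f : T -> Omega, injective f /\ {mono f : x y / r x y >-> (x <= y)%O})
    <-> [/\ reflexive r, antisymmetric r & transitive r];
  generic_homogeneous : forall (P : finPOrderType d) (a b : embedding P Omega),
    exists g : aut Omega, g \o a =1 b
}.

Section EmbeddingSpace.
Context (d : Order.disp_t) (Omega : porderType d).

Section Action.
Context (P : finPOrderType d).

Definition aut_emb (g : aut Omega) : embedding Omega Omega :=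
  Embedding (can_inj (@aut_funK _ _ g)) (@aut_mono _ _ g).

Definition emb_act (g : aut Omega) (e : embedding P Omega) :
  embedding P Omega := emb_comp (aut_emb g) e.

Lemma emb_act1 e : emb_act 1 e = e.
Proof. exact: emb_eq. Qed.

Lemma emb_actM g h e : emb_act (g * h) e = emb_act g (emb_act h e).
Proof. exact: emb_eq. Qed.

Definition emb_action : gaction Omega := GAction emb_act1 emb_actM.

Lemma emb_action_trans : generic_poset Omega -> transitive_action emb_action.
Proof.
move=> [_ age hom].
have [|f [fi fm]] := (age P (fun x y => (x <= y)%O)).2.
  split=> [x|x y|y x z]; [exact: lexx|exact: le_anti|exact: le_trans].
exists (Embedding fi fm : emb_action) => e.
have [g ge] := hom P (Embedding fi fm) e.
by exists g; exact: emb_eq.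
Qed.

Lemma emb_action_smooth : smooth emb_action.
Proof.
move=> e; rewrite aut_openE => g ge.
exists (range e); first by apply: finite_image; exact: finite_finset.
move=> _ [h hA <-]; apply: emb_eq => x /=.
rewrite (hA (e x)); last by exists x.
exact: (congr1 (fun e' : embedding P Omega => e' x) ge).
Qed.

Definition emb_tgset (gO : generic_poset Omega) : tgset Omega :=
  TGSet (emb_action_trans gO) emb_action_smooth.

End Action.

Lemma emb_restr_equiv (P Q : finPOrderType d) (alpha : embedding P Q)
    (g : aut Omega) (e : emb_action Q) :
  emb_comp (gact g e) alpha = gact g (emb_comp e alpha : emb_action P).
Proof. exact: emb_eq. Qed.

Definition emb_restr (P Q : finPOrderType d) (alpha : embedding P Q) :
  gmap (emb_action Q) (emb_action P) :=
  @GMap d Omega (emb_action Q) (emb_action P) (fun e => emb_comp e alpha)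
    (emb_restr_equiv alpha).

Definition prule_of_grule (gO : generic_poset Omega) (k : fieldType)
    (mu : grule Omega k) : prule d k :=
  fun P Q alpha => mu (emb_tgset Q gO) (emb_tgset P gO) (emb_restr alpha).

End EmbeddingSpace.

(* Main.v *)
Require Import Defs.
From mathcomp Require Import all_boot all_order all_algebra.
From HB Require Import structures.
From mathcomp Require Import boolp classical_sets functions cardinality.
From mathcomp Require Import topology.

Import Defs Order.TTheory GRing.Theory.

(** The embedding spaces Omega^[P] are only some of the transitive G-sets, but
    every transitive G-set X is a quotient of one of them by a finite group, and
    this determines the values of a measure on all maps once they are known on
    the restriction maps.

    Restriction. By universality and homogeneity of Omega, the orbits of G on
    Omega^[P'] x_(Omega^[P]) Omega^[Q] are the isomorphism classes of
    amalgamations of Q and P' over P, the orbit of an amalgamation with object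
    Q' being a copy of Omega^[Q'] ([realizes_iso]). So the axioms of a measure
    for G restrict to the axioms of a measure for finite posets
    ([restriction_pmeasure]).

    Supports. If the open stabilizer of a point x contains the pointwise
    stabilizers G(A) and G(B) of two finite sets, then it contains
    G(A :&: B) ([supportsI]). This is where the order matters: it holds because
    points can be added to finite posets freely, and would fail for a generic
    equivalence relation. Hence x has a least support A = supp x, which is
    permuted by the stabilizer of x, so that G(A) has finite index deg x in
    Stab(x).

    Uniqueness. The projection Omega^[A] -> X sending the inclusion of A to x
    is a covering with deg x sheets. Pulled back along itself it splits into
    deg x isomorphisms, so every measure takes the value deg x on it
    ([cover_value]). For f : Y -> X and x = f y we have supp x <= supp y, and
    the square formed by f, the two coverings and the restriction map forces
      mu(f) * deg y = deg x * nu(supp x -> supp y);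
    in characteristic 0 one can divide by deg y.

    Existence. This formula defines a rule [extension], visibly multiplicative
    and equal to 1 on isomorphisms. For a fibre product X' x_X Y over x, put
    A = supp x, B = supp x', C = supp y, V = Stab(x), H = Stab(x') and
    U = Stab(y). The orbits are the double cosets in H \ V / U. The measure
    axiom of nu, applied to each of the deg x cosets of G(A) in V, gives
      \sum_(g in G(B) \ V / G(C)) nu(B -> B u gC) = deg x * nu(A -> C)
    ([relnu_coset_sum]), and H v U breaks into
    deg x' * deg y / deg (x', v y) double cosets of G(B) and G(C)
    ([card_double_coset]); the axiom for [extension] follows on dividing by
    deg y. *)


Set Implicit Arguments.
Unset Strict Implicit.
Unset Printing Implicit Defensive.

(** * Finite subposets, homogeneity and free one-point extensions *)

Definition subposet (d : Order.disp_t) (Omega : porderType d) (s : seq Omega) :=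
  seq_sub s.

Section Subposet.
Context (d : Order.disp_t) (Omega : porderType d) (s : seq Omega).
HB.instance Definition _ := SubChoice.on (subposet s).
HB.instance Definition _ := Finite.on (subposet s).
HB.instance Definition _ :=
  [SubChoice_isSubPOrder of subposet s by <: with d].

Definition subposet_emb : embedding (subposet s) Omega :=
  @Embedding d (subposet s) Omega val val_inj (fun x y => leEsub x y).
End Subposet.

Section Homogeneity.
Context (d : Order.disp_t) (Omega : porderType d) (gO : generic_poset Omega).
Local Open Scope order_scope.
Implicit Types (s t : seq Omega) (a b x y : Omega) (g h : aut Omega).

(** Homogeneity for partial maps: an order-preserving and order-reflecting map
    on a finite list is automatically injective there, by antisymmetry. *)
Lemma mono_aut s (f : Omega -> Omega) :
  {in s &, {mono f : x y / x <= y}} ->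
  exists g : aut Omega, {in s, forall x, g x = f x}.
Proof.
move=> fm.
have fm' : {mono (f \o val : subposet s -> Omega) : x y / x <= y}.
  by move=> x y /=; rewrite fm ?leEsub //; exact: ssvalP.
have fi : injective (f \o val : subposet s -> Omega).
  by move=> x y E; apply: le_anti; rewrite -!fm' E lexx.
have [g gE] := generic_homogeneous gO (subposet_emb s) (Embedding fi fm').
by exists g => x xs; exact: (gE (SeqSub xs)).
Qed.

(** The quantifier-free type over s: for b outside s it is all that homogeneity
    can see of b. *)
Definition same_type s a b :=
  {in s, forall c, (c <= b) = (c <= a) /\ (b <= c) = (a <= c)}.

Lemma type_aut s a b : same_type s a b ->
  exists g, {in s, forall c, g c = c} /\ g a = b.
Proof.
move=> ab; pose f x := if x == a then b else x.
have [|g gf] := @mono_aut (a :: s) f.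
  move=> x y; rewrite !inE /f.
  case: (eqVneq x a) => [->|xa]; case: (eqVneq y a) => [->|ya] //= xs ys.
  - by rewrite !lexx.
  - exact: (ab _ ys).2.
  - exact: (ab _ xs).1.
exists g; split; last by rewrite gf ?mem_head // /f eqxx.
move=> c cs; rewrite gf ?inE ?cs ?orbT // /f; case: eqP cs => // -> /ab[].
by rewrite !lexx => ba ab'; apply: le_anti; rewrite ba ab'.
Qed.

(** The free amalgam over s of a new point of the type of a with t: the new
    point is related to a point of t only through a point of s. Freeness makes
    this relation transitive, and a not being in s makes it antisymmetric;
    universality then realizes it in Omega, and homogeneity moves the old
    points back to their places. *)
Lemma free_copy s t a : a \notin s -> exists2 b, same_type s a b &
  {in t, forall x, (x <= b -> exists2 c, c \in s & x <= c <= a) /\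
                   (b <= x -> exists2 c, c \in s & a <= c <= x)}.
Proof.
move=> aNs; pose D := subposet (s ++ t).
pose below x := has (fun c => x <= c <= a) s.
pose above x := has (fun c => a <= c <= x) s.
pose r (u v : option D) := match u, v with
  | Some x, Some y => val x <= val y
  | Some x, None => below (val x)
  | None, Some y => above (val y)
  | None, None => true end.
(* A point both above and below would squeeze a point of s onto a. *)
have NabN x : above x -> below x -> False.
  move=> /hasP[c cs /andP[ac cx]] /hasP[c' _ /andP[xc' c'a]].
  have ca : c <= a by apply: le_trans cx (le_trans xc' c'a).
  by move: aNs; rewrite (@le_anti _ _ a c) ?cs // ac ca.
have [|f [fi fm]] := (generic_age gO r).2.
  split=> [[x|]|[x|] [y|]|[y|] [x|] [z|]] //=.
  - by move/le_anti/val_inj->.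
  - by move=> /andP[bx ax]; case: (NabN _ ax bx).
  - by move=> /andP[ax bx]; case: (NabN _ ax bx).
  - exact: le_trans.
  - move=> xy /hasP[c cs /andP[yc ca]]; apply/hasP; exists c => //.
    by rewrite ca (le_trans xy yc).
  - move=> /hasP[c cs /andP[ac cy]] yz; apply/hasP; exists c => //.
    by rewrite ac (le_trans cy yz).
  - move=> /hasP[c cs /andP[xc ca]] /hasP[c' _ /andP[ac' c'z]].
    exact: le_trans xc (le_trans ca (le_trans ac' c'z)).
have fSm : {mono (f \o Some : D -> Omega) : x y / x <= y} by move=> x y; rewrite /= fm.
have fSi : injective (f \o Some : D -> Omega) by move=> x y /fi[].
have [g gE] := generic_homogeneous gO (Embedding fSi fSm) (subposet_emb (s ++ t)).
have belowE x : x \in s ++ t -> (x <= g (f None)) = below x.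
  move=> xs; have /= {1}<- := gE (SeqSub xs : D).
  by rewrite aut_mono fm.
have aboveE x : x \in s ++ t -> (g (f None) <= x) = above x.
  move=> xs; have /= {1}<- := gE (SeqSub xs : D).
  by rewrite aut_mono fm.
exists (g (f None)).
  move=> c cs; rewrite belowE ?aboveE ?mem_cat ?cs //; split; apply/hasP/idP.
  - by case=> c' _ /andP[]; exact: le_trans.
  - by move=> ca; exists c; rewrite // lexx.
  - by case=> c' _ /andP[]; exact: le_trans.
  - by move=> ac; exists c; rewrite // lexx ac.
move=> x xt; rewrite belowE ?aboveE ?mem_cat ?xt ?orbT //.
by split=> /hasP[c cs ?]; exists c.
Qed.

(** A point x of the type of a over s that was below the free copy would be
    below some c in s with c <= a, hence c <= x, so x = c; but then a = c. *)
Lemma incomparable_copy s t a : a \notin s -> {in t, forall x, same_type s a x} ->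
  exists2 b, same_type s a b & {in t, forall x, ~~ (x <= b) /\ ~~ (b <= x)}.
Proof.
move=> aNs tP; have [b ab bt] := free_copy t aNs; exists b => // x xt.
have [xb bx] := bt x xt.
split; apply/negP; [move=> /xb|move=> /bx]; case=> c cs /andP[H1 H2]; move: aNs;
  have [E1 E2] := tP x xt c cs.
- by rewrite (@le_anti _ _ a c) ?cs // -E2 H1.
- by rewrite (@le_anti _ _ a c) ?cs // -E1 H1.
Qed.
End Homogeneity.

(** * Least supports *)

Definition fixes (d : Order.disp_t) (Omega : porderType d) (s : seq Omega) (g : aut Omega) :=
  {in s, forall a, g a = a}.

Section Support.
Context (d : Order.disp_t) (Omega : porderType d) (gO : generic_poset Omega).
Local Open Scope group_scope.
Context (X : gaction Omega).
Implicit Types (s t u v w : seq Omega) (a b : Omega) (x y : X) (g h : aut Omega).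

Definition supports s x := forall g, fixes s g -> gact g x = x.

Lemma supports_sub s t x : {subset s <= t} -> supports s x -> supports t x.
Proof. by move=> st sx g gt; apply: sx => a /st /gt. Qed.

Lemma supports_act g s x : supports s x -> supports (map g s) (gact g x).
Proof.
move=> sx h hs; rewrite -[in RHS](sx (g^-1 * h * g)) -?gactM.
  by rewrite !mulgA mulgV mul1g.
by move=> a As; apply: (can_inj (@aut_funK _ _ g)); rewrite /= aut_invK hs ?map_f.
Qed.

Lemma supports_fix g s x : gact g x = x -> supports s x -> supports (map g s) x.
Proof. by move=> gx sx; rewrite -gx; exact: supports_act. Qed.

(** The heart of the intersection property. Write K for the stabilizer of x.
    Moving a by the fixer of b :: s gives a2 incomparable with a, of the same
    type over s, such that a2 :: s is a support too. For an arbitrary g fixing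
    s, choose a3 of that same type incomparable with both a and a' = g a. The
    pairs (a, a2) and (a, a3) have the same type over s, so a3 :: s is again a
    support; and (a3, a) and (a3, a') have the same type over s, so some k
    fixing a3 :: s, hence in K, sends a to a'. Then k^-1 * g fixes a :: s, so
    it lies in K, and so does g. *)
Lemma supports_cons2 s a b x : a != b ->
  supports (a :: s) x -> supports (b :: s) x -> supports s x.
Proof.
move=> ab ax bx.
have [As|aNs] := boolP (a \in s).
  by apply: supports_sub ax => c; rewrite inE => /predU1P[->|].
have [||a2 a2t a2a] := @incomparable_copy _ _ gO (b :: s) [:: a] a.
- by rewrite inE negb_or ab.
- by move=> c; rewrite inE => /eqP-> e _.
have [g2 [g2s g2a]] := type_aut gO a2t.
have a2x : supports (a2 :: s) x.
  have -> : a2 :: s = map g2 (a :: s).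
    by rewrite /= g2a map_id_in // => c cs; apply: g2s; rewrite inE cs orbT.
  by apply: supports_fix ax; exact: bx.
move=> g gs; pose a' := g a.
have aa' : same_type s a a'.
  by move=> c cs; rewrite -{1 3}(gs c cs) !aut_mono.
have [|a3 a3t a3a] := @incomparable_copy _ _ gO s [:: a; a'] a aNs.
  by move=> c; rewrite !inE => /orP[] /eqP-> // e _.
have [/negbTE aa2 /negbTE a2a'] := a2a a (mem_head _ _).
have [/negbTE aa3 /negbTE a3a'] := a3a a (mem_head _ _).
have [/negbTE a'a3 /negbTE a3a''] := a3a a' (mem_last a [:: a']).
have [|m [ms ma2]] := @type_aut _ _ gO (a :: s) a2 a3.
  move=> c; rewrite inE => /predU1P[->|cs].
    by rewrite aa2 a2a' aa3 a3a'.
  have [-> ->] := a3t c cs.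
  by have [|-> ->] := a2t c _; rewrite // inE cs orbT.
have a3x : supports (a3 :: s) x.
  have -> : a3 :: s = map m (a2 :: s).
    by rewrite /= ma2 map_id_in // => c cs; apply: ms; rewrite inE cs orbT.
  by apply: supports_fix a2x; exact: ax.
have [|k [ks ka]] := @type_aut _ _ gO (a3 :: s) a a'.
  move=> c; rewrite inE => /predU1P[->|cs].
    by rewrite aa3 a3a' a'a3 a3a''.
  exact: aa'.
have gkx : gact (k^-1 * g) x = x.
  apply: ax => c; rewrite inE => /predU1P[->|cs] /=.
    by rewrite -/a' -ka aut_funK.
  by rewrite gs // -[in LHS](ks c) ?inE ?cs ?orbT // aut_funK.
by rewrite -[g](mulVKg k) gactM gkx a3x.
Qed.

(** Removes the elements of u one at a time; each of them is removed by playing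
    it against the elements of v in turn. *)
Lemma supports_cat u v w x : {in u, forall a, a \notin v} ->
  supports (u ++ w) x -> supports (v ++ w) x -> supports w x.
Proof.
elim: u => //= a u IHu uv auw vw; apply: IHu (vw).
  by move=> c cu; apply: uv; rewrite inE cu orbT.
have {uv} : a \notin v by apply: uv; rewrite mem_head.
have {vw} : supports (v ++ u ++ w) x.
  by apply: supports_sub vw => c; rewrite !mem_cat => /orP[]->; rewrite ?orbT.
elim: v => //= b v IHv bvuw; rewrite inE negb_or => /andP[ab av].
apply: IHv => //; apply: (supports_cons2 ab) => //.
by apply: supports_sub auw => c; rewrite !inE !mem_cat => /or3P[]->; rewrite ?orbT.
Qed.

Lemma supportsI s t x : supports s x -> supports t x ->
  supports [seq a <- s | a \in t] x.
Proof.
move=> sx tx.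
apply: (@supports_cat [seq a <- s | a \notin t] [seq a <- t | a \notin s]).
- by move=> c; rewrite !mem_filter => /andP[_ ->].
- apply: supports_sub sx => c cs; rewrite mem_cat !mem_filter cs.
  by case: (c \in t).
- apply: supports_sub tx => c ct; rewrite mem_cat !mem_filter ct.
  by case: (c \in s).
Qed.

Lemma exists_support : smooth X -> forall x,
  exists s, supports s x /\ forall t, supports t x -> (size s <= size t)%N.
Proof.
move=> sX x; have ex : exists n, `[< exists s, supports s x /\ size s = n >].
  have [|A fA Ax] := sX x 1; first exact: gact1.
  have [s sA] := (finite_seqP A).1 fA.
  exists (size s); apply/asboolP; exists s; split=> // g gs.
  apply: Ax; exists g; last by rewrite mul1g.
  by move=> a; rewrite sA /= => /gs.
have [n /asboolP[s [sx <-]] nmin] := ex_minnP ex.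
by exists s; split=> // t tx; apply: nmin; apply/asboolP; exists t.
Qed.

Context (sX : smooth X).

(** A support of least size. It is a list rather than a set, so only its
    membership predicate is canonical. *)
Definition supp x : seq Omega := projT1 (cid (exists_support sX x)).

Lemma supp_supports x : supports (supp x) x.
Proof. by rewrite /supp; case: cid => s []. Qed.

(** The intersection of supp x with t is a support, so it cannot be smaller. *)
Lemma supp_min x t : supports t x -> {subset supp x <= t}.
Proof.
move=> tx; have := supportsI (@supp_supports x) tx.
rewrite /supp; case: cid => s [sx smin] /= /smin; rewrite size_filter => ge.
by apply/allP; rewrite all_count eqn_leq ge count_size.
Qed.

Lemma supp_act g x : supp (gact g x) =i map g (supp x).
Proof.
suff le h y : {subset supp (gact h y) <= map h (supp y)}.
  move=> a; apply/idP/idP; first exact: le.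
  move=> /mapP[b bx ->]; have := le g^-1 (gact g x).
  rewrite -gactM mulVg gact1 => /(_ b bx) /mapP[c cx ->].
  by rewrite /= aut_invK.
by apply: supp_min; apply: supports_act; exact: supp_supports.
Qed.

Lemma supp_stab g x : gact g x = x -> supp x =i map g (supp x).
Proof. by move=> gx a; rewrite -supp_act gx. Qed.


End Support.

Lemma supp_gmap (d : Order.disp_t) (Omega : porderType d) (gO : generic_poset Omega)
  (Y X : gaction Omega) (sY : smooth Y) (sX : smooth X) (f : gmap Y X) y :
  {subset supp sX (f y) <= supp sY y}.
Proof.
apply: (supp_min gO) => g gy; rewrite -gmap_equiv; congr (f _).
exact: supp_supports gy.
Qed.

(** * Systems of representatives and the degree of a point *)

(** R is meant to be an equivalence relation on S; indexing by an arbitrary type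
    lets the orbits, cosets and double cosets below share one notion. *)
Definition class_reps (T J : Type) (S : T -> Prop) (R : T -> T -> Prop)
    (r : J -> T) :=
  (forall j, S (r j)) /\ forall w, S w -> exists! j, R (r j) w.

(** Classes separated by an invariant with finitely many values are finitely many. *)
Lemma exists_class_reps (T : Type) (I : finType) (S : T -> Prop) (R : T -> T -> Prop)
    (c : T -> I) : (forall x y, S x -> S y -> (c x = c y <-> R x y)) ->
  exists n (r : 'I_n -> T), class_reps S R r.
Proof.
move=> cR; pose D := [set i | `[< exists2 x, S x & c x = i >]]%SET.
have rD (i : 'I_#|D|) : exists x, S x /\ c x = enum_val i.
  by have := enum_valP i; rewrite inE => /asboolP[x Sx cx]; exists x.
have [r rP] := choice rD; exists #|D|, r; split=> [i|w Sw]; first by have [] := rP i.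
have Dw : c w \in D by rewrite inE; apply/asboolP; exists w.
exists (enum_rank_in Dw (c w)); split=> [|j].
  have [Sr cr] := rP (enum_rank_in Dw (c w)).
  by apply/cR => //; rewrite cr enum_rankK_in.
have [Sr cr] := rP j => /(cR _ _ Sr Sw) crw.
by apply: enum_val_inj; rewrite enum_rankK_in // -crw.
Qed.

Lemma class_reps_card (T : Type) (I J : finType) (S : T -> Prop) (R : T -> T -> Prop)
    (r : I -> T) (r' : J -> T) :
  (forall x y, R x y -> R y x) -> (forall x y z, R x y -> R y z -> R x z) ->
  class_reps S R r -> class_reps S R r' -> #|I| = #|J|.
Proof.
move=> Rsym Rtrans; suff le (K L : finType) (p : K -> T) (q : L -> T) :
    class_reps S R p -> class_reps S R q -> (#|K| <= #|L|)%N.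
  by move=> tr tr'; apply/eqP; rewrite eqn_leq (le _ _ r r') // (le _ _ r' r).
move=> [Sp pU] [Sq qU].
have qp k : exists l, R (q l) (p k) by have [l []] := qU _ (Sp k); exists l.
have [f fP] := choice qp.
apply: (@leq_card _ _ f) => k k' ff.
have [l [_ lU]] := pU _ (Sp k).
rewrite -(lU k); last by apply: Rtrans (Rsym _ _ (fP k)) (fP k).
by apply: lU; apply: Rtrans (Rsym _ _ (fP k')) _; rewrite -ff; exact: fP.
Qed.

Lemma inj_surj_bij (T U : Type) (f : T -> U) :
  injective f -> (forall u, exists t, f t = u) -> bijective f.
Proof.
by move=> fi /choice[h fh]; exists h => // t; apply: fi; rewrite fh.
Qed.

Section Degree.
Context (d : Order.disp_t) (Omega : porderType d) (gO : generic_poset Omega).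
Local Open Scope group_scope.

Definition agree (s : seq Omega) (g h : aut Omega) := {in s, g =1 h}.

Lemma agree_sym s g h : agree s g h -> agree s h g.
Proof. by move=> gh a As; rewrite gh. Qed.

Lemma agree_trans s g h k : agree s g h -> agree s h k -> agree s g k.
Proof. by move=> gh hk a As; rewrite gh ?hk. Qed.

Context (X : gaction Omega) (sX : smooth X).
Implicit Types (x : X) (g h : aut Omega).
Local Notation supp := (supp sX).

(** Left cosets of the fixer of supp x in the stabilizer of x. *)
Definition coset_reps x (J : Type) (p : J -> aut Omega) :=
  class_reps (stabilizer x) (agree (supp x)) p.

Lemma agree_gact x g h : agree (supp x) g h -> gact g x = gact h x.
Proof.
move=> gh; rewrite -[g](mulVKg h) gactM; congr (gact h _).
by apply: (@supp_supports _ _ _ sX x) => a As /=; rewrite gh // aut_funK.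
Qed.

(** An element of the stabilizer permutes supp x, so its coset is known from the
    graph of that permutation. *)
Lemma exists_cosets x : exists n (p : 'I_n -> aut Omega), coset_reps x p.
Proof.
pose sp := subposet (supp x).
apply: (@exists_class_reps _ {ffun sp * sp -> bool} _ _
  (fun g => [ffun p => g (val p.1) == val p.2])) => g h gx hx; split.
  move=> /ffunP E a As; have gas : g a \in supp x.
    by rewrite (supp_stab gO sX gx) map_f.
  have := E (SeqSub As : sp, SeqSub gas : sp).
  by rewrite !ffunE /= eqxx => /esym/eqP.
by move=> gh; apply/ffunP => -[[a As] b]; rewrite !ffunE /= gh.
Qed.

(** The index of the fixer of supp x in the stabilizer of x. *)
Definition deg x : nat := projT1 (cid (exists_cosets x)).

Lemma deg_cosets x : exists p : 'I_(deg x) -> aut Omega, coset_reps x p.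
Proof. by rewrite /deg; case: cid. Qed.

Lemma deg_card x (J : finType) (p : J -> aut Omega) : coset_reps x p -> deg x = #|J|.
Proof.
have [q xq] := deg_cosets x => xp; rewrite -[LHS]card_ord.
exact: class_reps_card (@agree_sym _) (@agree_trans _) xq xp.
Qed.

Lemma deg_gt0 x : (0 < deg x)%N.
Proof.
have [p [_ /(_ 1 (gact1 x))[j _]]] := deg_cosets x.
exact: leq_ltn_trans (ltn_ord j).
Qed.

Lemma deg_act g x : deg (gact g x) = deg x.
Proof.
have [p [pS pU]] := deg_cosets x.
rewrite (@deg_card (gact g x) _ (fun i => g * p i * g^-1)) ?card_ord //; split.
  by move=> i; rewrite /stabilizer /= -gactM mulgVK gactM pS.
move=> h hgx; have : stabilizer x (g^-1 * h * g).
  by rewrite /stabilizer /= !gactM hgx -gactM mulVg gact1.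
move=> /pU[i [ih iU]]; exists i; split=> [a|j jh].
  rewrite (supp_act gO) => /mapP[b bx ->] /=; rewrite aut_funK ih //=.
  by rewrite aut_invK.
apply: iU => a ax; apply: (can_inj (@aut_funK _ _ g)) => /=.
have := jh (g a); rewrite (supp_act gO) map_f // => /(_ isT) /=.
by rewrite aut_funK aut_invK.
Qed.
End Degree.

Lemma supp_stab_eq (d : Order.disp_t) (Omega : porderType d) (gO : generic_poset Omega)
    (X Y : gaction Omega) (sX : smooth X) (sY : smooth Y) (x : X) (y : Y) :
  stabilizer x = stabilizer y -> supp sX x =i supp sY y.
Proof.
move=> xy; have le (X' Y' : gaction Omega) (sX' : smooth X') (sY' : smooth Y')
    (x' : X') (y' : Y') :
    stabilizer x' = stabilizer y' -> {subset supp sX' x' <= supp sY' y'}.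
  move=> E; apply: (supp_min gO) => g gy.
  have : stabilizer y' g by exact: (@supp_supports _ _ _ sY' y').
  by rewrite -E.
by move=> a; apply/idP/idP; apply: le.
Qed.

Lemma deg_stab (d : Order.disp_t) (Omega : porderType d) (gO : generic_poset Omega)
    (X Y : gaction Omega) (sX : smooth X) (sY : smooth Y) (x : X) (y : Y) :
  stabilizer x = stabilizer y -> deg gO sX x = deg gO sY y.
Proof.
move=> xy; have sxy := supp_stab_eq gO sX sY xy.
have [p [pS pU]] := deg_cosets gO sX x; rewrite -[LHS]card_ord; apply/esym.
apply: (@deg_card _ _ _ _ _ _ _ p); rewrite /coset_reps -xy; split=> // h /pU[i [ih iU]].
exists i; split=> [a ay|j jh]; first by apply: ih; rewrite sxy.
by apply: iU => a ax; apply: jh; rewrite -sxy.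
Qed.

Section EmbeddingSupport.
Context (d : Order.disp_t) (Omega : porderType d) (gO : generic_poset Omega).
Context (P : finPOrderType d).
Local Notation sE := (@emb_action_smooth d Omega P).

(** There is no algebraicity: a point outside s has an incomparable copy over s,
    so a set supporting e cannot omit a value of e. *)
Lemma supp_emb (e : embedding P Omega) : supp sE e =i codom e.
Proof.
move=> a; apply/idP/idP; first apply: (supp_min gO).
  by move=> g ge; apply: emb_eq => p /=; apply: ge; exact: codom_f.
move=> /codomP[p ->]; apply: contraT => eps.
have [|b /(type_aut gO)[g [gs ga]] /(_ _ (mem_head _ _))[epb _]] :=
  @incomparable_copy _ _ gO _ [:: e p] _ eps.
  by move=> x; rewrite inE => /eqP->.
have /(congr1 (fun f : embedding P Omega => f p)) /= := @supp_supports _ _ _ sE e g gs.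
by rewrite ga => bE; rewrite bE lexx in epb.
Qed.

Lemma deg_emb (e : embedding P Omega) : deg gO sE e = 1%N.
Proof.
rewrite (@deg_card _ _ _ _ _ _ 'I_1 (fun=> 1%g)) ?card_ord //.
split=> [_|g ge]; first exact: (@gact1 _ _ (emb_action Omega P)).
exists ord0; split=> [a|j _]; last by rewrite [j]ord1.
rewrite supp_emb => /codomP[p ->] /=.
by have /(congr1 (fun f : embedding P Omega => f p)) /= -> := ge.
Qed.
End EmbeddingSupport.

(** * Orbits on fibre products of embedding spaces are amalgamations *)

Section Corestriction.
Context (d : Order.disp_t) (Omega : porderType d).

Lemma emb_corestr (P : finPOrderType d) (e : embedding P Omega) (s : seq Omega) :
  {subset codom e <= s} -> exists phi : embedding P (subposet s),
    (forall p, val (phi p) = e p) /\ (s =i codom e -> bijective phi).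
Proof.
move=> es; pose phi p : subposet s := SeqSub (es _ (codom_f e p)).
have phi_inj : injective phi by move=> p q /(congr1 val) /= /emb_inj.
have phi_mono : {mono phi : p q / (p <= q)%O} by move=> p q; rewrite -(emb_mono e).
exists (Embedding phi_inj phi_mono); split=> // se.
apply: inj_surj_bij => // -[a As]; have := As; rewrite se => /codomP[p ap].
by exists p; exact: val_inj.
Qed.

End Corestriction.

Section AmalgamationOrbits.
Context (d : Order.disp_t) (Omega : porderType d) (gO : generic_poset Omega).
Context (P Q P' : finPOrderType d) (alpha : embedding P Q) (beta : embedding P P').
Local Notation pairs := (fiber_product (emb_restr Omega beta) (emb_restr Omega alpha)).

(** An amalgamation placed in Omega restricts to a pair of embeddings agreeing
    on P, that is to a point of the fibre product. *)
Definition realizes (A : amalgamation alpha beta) (e : embedding (amalg_obj A) Omega)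
    (w : pairs) : Prop :=
  (sval w).1 = emb_comp e (amalg_alpha A) /\ (sval w).2 = emb_comp e (amalg_beta A).

Lemma realize_amalgamation (A : amalgamation alpha beta) :
  exists w, exists e : embedding (amalg_obj A) Omega, realizes e w.
Proof.
have [e _] := emb_action_trans (amalg_obj A) gO.
pose p : emb_action Omega P' * emb_action Omega Q :=
  (emb_comp e (amalg_alpha A), emb_comp e (amalg_beta A)).
have pE : emb_restr Omega beta p.1 = emb_restr Omega alpha p.2.
  by apply: emb_eq => x /=; have /= -> := amalg_comm A x.
by exists (exist _ p pE), e.
Qed.

(** The amalgamation is the union of the two images inside Omega. *)
Lemma realized_by_amalgamation (w : pairs) :
  exists A, exists e : embedding (amalg_obj A) Omega, realizes e w.
Proof.
case: w => -[e' e] /= ee'; pose s := codom e' ++ codom e.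
have [|f' [f'E _]] := @emb_corestr _ _ _ e' s.
  by move=> a ae; rewrite mem_cat ae.
have [|f [fE _]] := @emb_corestr _ _ _ e s.
  by move=> a ae; rewrite mem_cat ae orbT.
have comm : f \o alpha =1 f' \o beta.
  move=> p; apply: val_inj; rewrite /= f'E fE.
  by have /(congr1 (fun u : embedding P Omega => u p)) /= := ee'.
have cover (z : subposet s) : (exists y, f' y = z) \/ (exists y, f y = z).
  case: z => a As; have := As; rewrite mem_cat => /orP[] /codomP[y ay].
    by left; exists y; apply: val_inj; rewrite f'E.
  by right; exists y; apply: val_inj; rewrite fE.
exists (Amalgamation comm cover), (subposet_emb s).
by split; apply: emb_eq => p /=; rewrite ?f'E ?fE.
Qed.

(** An isomorphism of amalgamations extends to Omega by homogeneity; conversely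
    an automorphism matching the two pairs matches the unions of their images. *)
Lemma realizes_iso (A B : amalgamation alpha beta)
    (e : embedding (amalg_obj A) Omega) (f : embedding (amalg_obj B) Omega)
    (w v : pairs) :
  realizes e w -> realizes f v -> amalg_iso A B <-> in_orbit w v.
Proof.
case: w => -[w1 w2] /= wE [/= w1E w2E]; case: v => -[v1 v2] /= vE [/= v1E v2E].
subst w1 w2 v1 v2; split.
  move=> [phi [_ phiA phiB]]; have [g gE] := generic_homogeneous gO e (emb_comp f phi).
  exists g; apply: sval_eq => /=; congr pair; apply: emb_eq => p /=.
    by have /= -> := gE (amalg_alpha A p); have /= -> := phiA p.
  by have /= -> := gE (amalg_beta A p); have /= -> := phiB p.
move=> [g /(congr1 sval) gw].
have gA p : g (e (amalg_alpha A p)) = f (amalg_alpha B p).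
  exact: (congr1 (fun u : embedding P' Omega * embedding Q Omega => u.1 p) gw).
have gB p : g (e (amalg_beta A p)) = f (amalg_beta B p).
  exact: (congr1 (fun u : embedding P' Omega * embedding Q Omega => u.2 p) gw).
have gef z : exists y, f y = g (e z).
  case: (amalg_cover z) => -[p <-]; first by exists (amalg_alpha B p).
  by exists (amalg_beta B p).
have [phi phiE] := choice gef.
have phi_mono : {mono phi : x y / (x <= y)%O}.
  by move=> x y; rewrite -(emb_mono f) !phiE aut_mono emb_mono.
have phi_inj : injective phi.
  by move=> x y E; apply: le_anti; rewrite -!phi_mono E lexx.
have phiA p : phi (amalg_alpha A p) = amalg_alpha B p.
  by apply: (@emb_inj _ _ _ f); rewrite phiE gA.
have phiB p : phi (amalg_beta A p) = amalg_beta B p.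
  by apply: (@emb_inj _ _ _ f); rewrite phiE gB.
exists (Embedding phi_inj phi_mono); split=> //.
apply: inj_surj_bij => // z; case: (amalg_cover z) => -[p <-].
  by exists (amalg_alpha A p).
by exists (amalg_beta A p).
Qed.

Lemma orbit_reps_of_amalgamations r (A : 'I_r -> amalgamation alpha beta) :
  (forall B, exists! i, amalg_iso (A i) B) ->
  exists z : 'I_r -> pairs, (forall w, exists! i, in_orbit (z i) w) /\
    forall i, exists e : embedding (amalg_obj (A i)) Omega, realizes e (z i).
Proof.
move=> AU; have [z zP] := choice (fun i => realize_amalgamation (A i)).
exists z; split=> // w; have [B [f fw]] := realized_by_amalgamation w.
have [i [iB iU]] := AU B; exists i; split=> [|j jw].
  by have [e ez] := zP i; apply/(realizes_iso ez fw).
by apply: iU; have [e ez] := zP j; apply/(realizes_iso ez fw).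
Qed.

Lemma amalgamations_of_orbit_reps r (z : 'I_r -> pairs) :
  (forall w, exists! i, in_orbit (z i) w) ->
  exists A : 'I_r -> amalgamation alpha beta,
    (forall B, exists! i, amalg_iso (A i) B) /\
    forall i, exists e : embedding (amalg_obj (A i)) Omega, realizes e (z i).
Proof.
move=> zU; have [A AP] := choice (fun i => realized_by_amalgamation (z i)).
exists A; split=> // B; have [w [f fw]] := realize_amalgamation B.
have [i [iw iU]] := zU w; exists i; split=> [|j jB].
  by have [e ez] := AP i; apply/(realizes_iso ez fw).
by apply: iU; have [e ez] := AP j; apply/(realizes_iso ez fw).
Qed.

End AmalgamationOrbits.

Section Restriction.
Context (d : Order.disp_t) (Omega : porderType d) (gO : generic_poset Omega).
Context (k : fieldType).

(** The amalgamation axiom is the orbit axiom for two restriction maps, once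
    each orbit is identified with the embedding space of the amalgamation. *)
Lemma restriction_pmeasure (mu : grule Omega k) :
  is_gmeasure mu -> is_pmeasure (prule_of_grule gO mu).
Proof.
move=> [mu_iso mu_comp mu_orb]; split.
- move=> P Q alpha [h ah ha]; apply: mu_iso.
  have h_mono : {mono h : x y / (x <= y)%O} by move=> x y; rewrite -(emb_mono alpha) !ha.
  exists (fun e => emb_comp e (Embedding (can_inj ha) h_mono) : emb_action Omega Q) => e;
    by apply: emb_eq => x /=; rewrite ?ah ?ha.
- move=> P Q R beta alpha; rewrite /prule_of_grule -mulrC -mu_comp; congr mu.
  by apply: gmap_eq => e; apply: emb_eq.
move=> P Q P' alpha beta r A /(orbit_reps_of_amalgamations gO)[z [zU zA]].
rewrite /prule_of_grule (mu_orb (emb_tgset P' gO) (emb_tgset Q gO) (emb_tgset P gO)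
  (emb_restr Omega alpha) (emb_restr Omega beta) r z zU).
apply: eq_bigr => i _; have [e [e1 e2]] := zA i.
(* Psi below sends an embedding of the i-th amalgamation to its two
   restrictions; amalg_cover makes it injective. *)
pose S := emb_action Omega (amalg_obj (A i)).
pose O := @fiber_orbit d Omega (emb_tgset P' gO) (emb_tgset Q gO) (emb_tgset P gO)
  (emb_restr Omega beta) (emb_restr Omega alpha) (z i).
have SE (u : S) : exists g, gact g (e : S) = u.
  by have [g gE] := generic_homogeneous gO e u; exists g; exact: emb_eq.
have psiP (u : S) : exists v : O,
    (sval (sval v)).1 = emb_comp u (amalg_alpha (A i)) /\
    (sval (sval v)).2 = emb_comp u (amalg_beta (A i)).
  have [g <-] := SE u; have zg : in_orbit (z i) (gact g (z i)) by exists g.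
  by exists (exist _ _ zg); rewrite /= e1 e2; split; exact: emb_eq.
have [psi psiE] := choice psiP.
have psi_eq g u : psi (gact g u) = gact g (psi u).
  apply: sval_eq; apply: sval_eq => /=; rewrite [LHS]surjective_pairing.
  by rewrite !(psiE _).1 !(psiE _).2; congr pair; exact: emb_eq.
pose Psi : gmap (emb_tgset (amalg_obj (A i)) gO) O :=
  @GMap _ _ S O psi psi_eq.
have Psi_bij : bijective Psi.
  apply: inj_surj_bij => [u v uv|[v zv]].
    have [u1 u2] := psiE u; have [v1 v2] := psiE v.
    rewrite (uv : psi u = psi v) v1 in u1; rewrite (uv : psi u = psi v) v2 in u2.
    apply: emb_eq => x; case: (amalg_cover x) => -[p <-].
      exact: (congr1 (fun w : embedding P' Omega => w p) (esym u1)).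
    exact: (congr1 (fun w : embedding Q Omega => w p) (esym u2)).
  have [g gv] := zv; exists (gact g (e : S)); apply: sval_eq => /=; rewrite -gv.
  apply: sval_eq => /=; rewrite [LHS]surjective_pairing !(psiE _).1 !(psiE _).2 e1 e2.
  by congr pair; exact: emb_eq.
pose pr : gmap O (emb_tgset P' gO) := @fiber_orbit_proj d Omega (emb_tgset P' gO)
  (emb_tgset Q gO) (emb_tgset P gO) (emb_restr Omega beta) (emb_restr Omega alpha) (z i).
have := mu_comp _ _ _ pr Psi; rewrite (mu_iso _ _ _ Psi_bij) mulr1 => <-; congr mu.
by apply: gmap_eq => u /=; rewrite (psiE u).1.
Qed.

End Restriction.

(** * Counting double cosets *)

Section DoubleCosets.
Local Open Scope group_scope.
Context (G : groupType).
Implicit Types (K H N U M V : G -> Prop) (g h u v : G).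

Definition is_subgroup K :=
  [/\ K 1, (forall g h, K g -> K h -> K (g * h)) & forall g, K g -> K g^-1].

Definition normalizes H N := forall h n, H h -> N n -> N (h * n * h^-1).

Definition double_coset H U g h := exists x y, [/\ H x, U y & x * g * y = h].

Definition same_coset N g h := N (g^-1 * h).

Context (H N U M : G -> Prop).
Hypotheses (sH : is_subgroup H) (sN : is_subgroup N).
Hypotheses (sU : is_subgroup U) (sM : is_subgroup M).
Hypotheses (nHN : normalizes H N) (nUM : normalizes U M).
Hypotheses (NH : forall g, N g -> H g) (MU : forall g, M g -> U g).
Context (V : G -> Prop) (VHU : forall h v u, H h -> V v -> U u -> V (h * v * u)).
Context (I1 I2 J : finType) (p : I1 -> G) (q : I2 -> G) (w : J -> G).
Hypotheses (pP : class_reps H (same_coset N) p) (qP : class_reps U (same_coset M) q).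
Hypothesis wP : class_reps V (double_coset N M) w.

Lemma double_coset_sym H' U' g h : is_subgroup H' -> is_subgroup U' ->
  double_coset H' U' g h -> double_coset H' U' h g.
Proof.
move=> [_ _ H'V] [_ _ U'V] [x [y [hx uy <-]]]; exists x^-1, y^-1; split; auto.
by rewrite !mulgA mulVg mul1g mulgK.
Qed.

Lemma double_coset_trans H' U' g h k : is_subgroup H' -> is_subgroup U' ->
  double_coset H' U' g h -> double_coset H' U' h k -> double_coset H' U' g k.
Proof.
move=> [_ H'M _] [_ U'M _] [x [y [hx uy <-]]] [x' [y' [hx' uy' <-]]].
by exists (x' * x), (y * y'); split; [exact: H'M|exact: U'M|rewrite !mulgA].
Qed.

Lemma double_coset_sub g h : double_coset N M g h -> double_coset H U g h.
Proof. by move=> [x [y [nx my <-]]]; exists x, y; split; auto. Qed.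

(** H x U acts transitively on H v U, with the stabilizer of v isomorphic to
    the intersection of H with v U v^-1. The orbits of the normal subgroup
    N x M number [H : N] [U : M] divided by the index of the trace of N x M on
    that stabilizer, which is #|L|. *)
Lemma card_double_coset v (L : finType) (tau : L -> G) :
    V v ->
    class_reps (fun g => H g /\ U (v^-1 * g * v))
      (fun g h => same_coset N g h /\ M (v^-1 * (g^-1 * h) * v)) tau ->
  (#|[set j : J | `[< double_coset H U v (w j) >]]%SET| * #|L| = #|I1| * #|I2|)%N.
Proof.
move=> Vv [tauS tauU].
have [_ HM HV] := sH; have [_ UM UV] := sU.
have [_ NM NV] := sN; have [_ MM MV] := sM.
have [pS pU] := pP; have [qS qU] := qP; have [wS wU] := wP.
(* phi maps a pair of cosets to the double coset of N and M that it spans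
   around v; each fibre over a double coset in H v U has #|L| elements. *)
have phiP (st : I1 * I2) : exists j, double_coset N M (w j) (p st.1 * v * q st.2).
  by have [|j [jw _]] := wU (p st.1 * v * q st.2); [exact: VHU|exists j].
have [phi phiE] := choice phiP.
have phiH st : double_coset H U v (w (phi st)).
  apply: (double_coset_trans sH sU (h := p st.1 * v * q st.2)).
    by exists (p st.1), (q st.2).
  by apply/double_coset_sub/double_coset_sym.
have phi_eq st j : double_coset N M (w j) (p st.1 * v * q st.2) -> phi st = j.
  move=> jst; have [|i [_ iU]] := wU (p st.1 * v * q st.2); first exact: VHU.
  by rewrite -(iU _ (phiE st)) -(iU _ jst).
transitivity #|{: I1 * I2}|; last by rewrite card_prod.
pose D := [set j | `[< double_coset H U v (w j) >]]%SET.
rewrite -[RHS]sum1_card (partition_big phi (mem D)) /=; last first.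
  by move=> st _; rewrite inE; apply/asboolP.
rewrite -[LHS]sum_nat_const; apply: eq_bigr => j; rewrite inE => /asboolP[h [u [Hh Uu hvu]]].
rewrite sum1_card -cardsE.
(* Writing w j = h v u, the pairs over j are the classes of
   (h tau, v^-1 tau^-1 v u), for tau in the stabilizer of v. *)
have tauV e : U (v^-1 * (tau e)^-1 * v).
  by have [_ /UV] := tauS e; rewrite !invgM invgK mulgA.
have psiP e : exists st : I1 * I2, same_coset N (p st.1) (h * tau e) /\
    same_coset M (q st.2) (v^-1 * (tau e)^-1 * v * u).
  have [|s [sP _]] := pU (h * tau e); first by apply: HM => //; have [] := tauS e.
  have [|t [tP _]] := qU (v^-1 * (tau e)^-1 * v * u); first exact: UM.
  by exists (s, t).
have [psi psiE] := choice psiP.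
have psi_inj : injective psi.
  move=> e e' ee; have [[He Ue] [He' Ue']] := (tauS e, tauS e').
  have [es et] := psiE e; have [es' et'] := psiE e'; rewrite -{}ee in es' et'.
  have /tauU[i [_ iU]] := tauS e'.
  rewrite -(iU e); first by apply: iU; rewrite /same_coset mulVg mulg1 mulVg; case: sN; case: sM.
  have Nee : N ((tau e)^-1 * tau e').
    have -> : (tau e)^-1 * tau e' =
        ((p (psi e).1)^-1 * (h * tau e))^-1 * ((p (psi e).1)^-1 * (h * tau e')).
      by rewrite !invgM invgK !mulgA mulgK mulgVK.
    by apply: NM => //; exact: NV.
  split => //.
  have Mu : M (u^-1 * (v^-1 * (tau e * (tau e')^-1) * v) * u).
    have -> : u^-1 * (v^-1 * (tau e * (tau e')^-1) * v) * u =
        ((q (psi e).2)^-1 * (v^-1 * (tau e)^-1 * v * u))^-1 *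
        ((q (psi e).2)^-1 * (v^-1 * (tau e')^-1 * v * u)).
      by rewrite !invgM !invgK !mulgA !mulgK.
    by apply: MM => //; exact: MV.
  have {}Mu := nUM Uu Mu; rewrite !mulgA mulgV mul1g mulgK in Mu.
  have := nUM (UV _ Ue) (MV _ Mu).
  by rewrite !invgM !invgK !mulgA !mulgK !mulgVK.
rewrite -(card_imset _ psi_inj); apply: eq_card => -[s t].
transitivity (phi (s, t) == j); last by [].
apply/imsetP/eqP => [[e _ est]|].
  have [/= es et] := psiE e; rewrite -est /= in es et.
  apply: phi_eq => /=; exists (p s * ((p s)^-1 * (h * tau e))^-1 * (p s)^-1),
    ((q t)^-1 * (v^-1 * (tau e)^-1 * v * u))^-1.
  split; [by apply: nHN => //; apply: NV|exact: MV|].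
  rewrite -hvu !invgM !invgK !mulgA.
  by rewrite !mulgK !mulgVK.
move=> phij; have := phiE (s, t); rewrite phij /= => -[n [m [Nn Mm nwm]]].
(* Solve p s = n h t0 for the element t0 of the stabilizer. *)
pose t0 := h^-1 * n^-1 * p s.
have psE : p s = n * h * t0 by rewrite /t0 !mulgA mulgK mulgV mul1g.
have t0E : v^-1 * t0 * v = u * m * (q t)^-1.
  have ps : p s = n * w j * m * (q t)^-1 * v^-1 by rewrite nwm !mulgK.
  by rewrite /t0 ps -hvu !mulgA !mulgVK mulVg mul1g.
have qtE : q t = v^-1 * t0^-1 * v * u * m.
  by rewrite -[q t]invgK -(mulKg (u * m) (q t)^-1) -t0E !invgM !invgK !mulgA.
have [|e [[Ne Me] _]] := tauU t0.
  split; first by apply: (HM) => //; apply: (HM); [exact: HV|apply/HV/NH].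
  by rewrite t0E; apply: (UM); [apply: (UM) => //; exact: MU|exact: UV].
exists e => //; have [es et] := psiE e; have [He Ue] := tauS e.
have [|s' [_ sU']] := pU (h * tau e); first exact: HM.
have [|t' [_ tU']] := qU (v^-1 * (tau e)^-1 * v * u); first by apply: UM.
rewrite [psi e]surjective_pairing -(sU' _ es) -(tU' _ et); congr pair.
  apply/esym/sU'; rewrite /same_coset psE.
  have := NM _ _ (NV _ Ne) (nHN (HV _ (HM _ _ Hh He)) (NV _ Nn)).
  by rewrite !invgM !invgK !mulgA mulgK.
apply/esym/tU'; rewrite /same_coset qtE.
have := MM _ _ (MV _ Mm) (nUM (UV _ Uu) (nUM Ue Me)).
by rewrite !invgM !invgK !mulgA !mulgK.
Qed.

(** The previous count, summed over the double cosets of H and U in V. *)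
Lemma double_coset_sum (k : fieldType) (I : finType) (v : I -> G) (L : I -> finType)
    (tau : forall i, L i -> G) (F : G -> k) :
    class_reps V (double_coset H U) v ->
    (forall i, class_reps (fun g => H g /\ U ((v i)^-1 * g * v i))
      (fun g h => same_coset N g h /\ M ((v i)^-1 * (g^-1 * h) * v i)) (tau i)) ->
    (forall i, #|L i|%:R != 0 :> k)%R ->
    (forall g h, double_coset H U g h -> F g = F h) ->
  (\sum_j F (w j) = \sum_i F (v i) * (#|I1| * #|I2|)%:R / #|L i|%:R)%R.
Proof.
move=> [vS vU] tauP L_neq0 F_inv; have [wS _] := wP.
have kapP j : exists i, double_coset H U (v i) (w j).
  by have [i [iP _]] := vU _ (wS j); exists i.
have [kap kapE] := choice kapP.
rewrite (partition_big kap predT) //=; apply: eq_bigr => i _.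
have kapQ j : (kap j == i) = `[< double_coset H U (v i) (w j) >].
  apply/eqP/asboolP => [<-|ij]; first exact: kapE.
  have [i' [_ iU]] := vU _ (wS j).
  by rewrite -(iU _ (kapE j)) -(iU _ ij).
rewrite (eq_bigr (fun=> F (v i))); last by move=> j /eqP <-; rewrite (F_inv _ _ (kapE j)).
rewrite -(card_double_coset (vS i) (tauP i)) sumr_const natrM mulrA mulfK //.
rewrite mulr_natr; congr (_ *+ _)%R; apply: eq_card => j.
by rewrite inE -kapQ.
Qed.
End DoubleCosets.

(** * The value of a measure on an inclusion of finite subsets of Omega *)

Section RelativeValue.
Context (d : Order.disp_t) (Omega : porderType d) (gO : generic_poset Omega).
Context (k : fieldType) (nu : prule d k) (nuP : is_pmeasure nu).
Implicit Types (s t u : seq Omega) (g h : aut Omega).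

Lemma mem_catl s t (a : subposet s) : val a \in s ++ t.
Proof. by rewrite mem_cat; case: a => /= a ->. Qed.

Definition subposet_cat s t : embedding (subposet s) (subposet (s ++ t)).
Proof.
apply: (@Embedding _ (subposet s) (subposet (s ++ t))
  (fun a => SeqSub (mem_catl t a) : subposet (s ++ t))).
  by move=> a b /(congr1 val) /= /val_inj.
by move=> a b.
Defined.

Lemma codom_subposet_emb s : codom (subposet_emb s) =i s.
Proof.
move=> a; apply/codomP/idP => [[[b bs] ->]//|As].
by exists (SeqSub As : subposet s).
Qed.

(** The value of nu on the inclusion of s into the union of s and t. Taking the
    union makes the value defined for all pairs, without a proof of inclusion. *)
Definition relnu s t : k := nu (subposet_cat s t).

(** nu is invariant under isomorphisms on both sides, so its value on alpha can
    be read off from any copy of alpha inside Omega. *)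
Lemma relnuE (P Q : finPOrderType d) (alpha : embedding P Q) (e : embedding Q Omega) s t :
  codom (emb_comp e alpha) =i s -> codom e =i s ++ t -> nu alpha = relnu s t.
Proof.
move=> es est; have [nu_iso nu_comp _] := nuP.
have [|phi [phiE phiB]] := @emb_corestr _ _ _ e (s ++ t); first by move=> a; rewrite est.
have [|psi [psiE psiB]] := @emb_corestr _ _ _ (emb_comp e alpha) s; first by move=> a; rewrite es.
have {}psiB : bijective psi by apply: psiB => a; rewrite es.
have {}phiB : bijective phi by apply: phiB => a; rewrite est.
rewrite /relnu -[RHS]mulr1 -(nu_iso _ _ psi psiB) -nu_comp.
rewrite -[LHS]mul1r -(nu_iso _ _ phi phiB) -nu_comp; congr nu.
by apply: emb_eq => p; apply: val_inj; rewrite /= phiE psiE.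
Qed.

Lemma relnu_aut g s t s' t' :
  s' =i map g s -> s' ++ t' =i map g (s ++ t) -> relnu s' t' = relnu s t.
Proof.
move=> ss' tt'; apply/esym.
apply: (relnuE (e := emb_comp (aut_emb g) (subposet_emb (s ++ t)))) => a.
  rewrite ss'; apply/codomP/mapP => [[[b bs] ->]|[b bs ->]]; first by exists b.
  by exists (SeqSub bs : subposet s).
rewrite tt'; apply/codomP/mapP => [[[b bs] ->]|[b bs ->]]; first by exists b.
by exists (SeqSub bs : subposet (s ++ t)).
Qed.

Lemma relnu_mem s t s' t' : s' =i s -> s' ++ t' =i s ++ t -> relnu s' t' = relnu s t.
Proof. by move=> ss' tt'; apply: (@relnu_aut 1%g) => a; rewrite map_id. Qed.

Lemma relnu_self s t : {subset t <= s} -> relnu s t = 1%R.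
Proof.
move=> ts; have [nu_iso _ _] := nuP.
pose one : embedding (subposet s) (subposet s) :=
  Embedding (@inj_id _) (fun _ _ => erefl).
have one_bij : bijective one by exists id.
rewrite -(nu_iso _ _ one one_bij); apply/esym/(relnuE (e := subposet_emb s)) => a.
  exact: codom_subposet_emb.
rewrite codom_subposet_emb mem_cat.
by case: (boolP (a \in s)) => //= /negP aNs; apply/esym/negP => /ts.
Qed.

Lemma relnu_trans s t u : (relnu s t * relnu (s ++ t) u = relnu s (t ++ u))%R.
Proof.
have [_ nu_comp _] := nuP; rewrite mulrC -nu_comp.
apply: (relnuE (e := subposet_emb _)) => a; last by rewrite codom_subposet_emb catA.
apply/codomP/idP => [[[b bs] ->]//|As].
by exists (SeqSub As : subposet s).
Qed.

Lemma relnu_orbit_sum (P Q P' : finPOrderType d) (alpha : embedding P Q)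
    (beta : embedding P P') r
    (z : 'I_r -> fiber_product (emb_restr Omega beta) (emb_restr Omega alpha)) :
  (forall w, exists! i, in_orbit (z i) w) ->
  nu alpha = (\sum_(i < r) relnu (codom (sval (z i)).1) (codom (sval (z i)).2))%R.
Proof.
move=> /(amalgamations_of_orbit_reps gO)[A [AU Az]].
have [_ _ nu_amalg] := nuP; rewrite (nu_amalg _ _ _ _ _ _ _ AU).
apply: eq_bigr => i _; have [e [-> ->]] := Az i.
apply: (relnuE (e := e)) => // a; rewrite mem_cat; apply/codomP/orP.
  move=> [x ->]; case: (amalg_cover x) => -[p <-]; [left|right];
  by apply/codomP; exists p.
by case=> /codomP[p ->]; eexists.
Qed.

(** Double cosets of the fixers of u and t. Only the restriction of g to t
    matters, which spares the right-hand factor. *)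
Definition moves_by u t g h := exists2 n : aut Omega, fixes u n & agree t (n * g)%g h.

(** The double coset of g is known from the order relations between u and g t:
    if they coincide for g and h, the map that fixes u and sends g a to h a is
    well defined and extends to an automorphism. *)
Lemma exists_moves_by_reps (S : aut Omega -> Prop) u t :
  exists n (w : 'I_n -> aut Omega), class_reps S (moves_by u t) w.
Proof.
apply: (@exists_class_reps _ {ffun subposet u * subposet t -> bool * bool} _ _
  (fun g => [ffun p => (val p.1 <= g (val p.2), g (val p.2) <= val p.1)%O])) => g h _ _.
split=> [/ffunP E|[n nu_ ngh]]; last first.
  apply/ffunP => -[[b bu] [a At]]; rewrite !ffunE /= -ngh //= -{3 4}(nu_ b bu).
  by rewrite !aut_mono.
have gh a b : b \in u -> a \in t -> (b <= g a)%O = (b <= h a)%O /\ (g a <= b)%O = (h a <= b)%O.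
  move=> bu At; have := E (SeqSub bu : subposet u, SeqSub At : subposet t).
  by rewrite !ffunE /= => -[-> ->].
pose f x := if x \in u then x else h (aut_inv g x).
have fu b : b \in u -> f b = b by rewrite /f => ->.
have ft a : a \in t -> f (g a) = h a.
  rewrite /f => At; case: ifP => [gau|_]; last by rewrite aut_funK.
  have [] := gh a (g a) gau At; rewrite lexx => /esym h1 /esym h2.
  by apply: le_anti; rewrite h1 h2.
have [|n nf] := @mono_aut _ _ gO (u ++ map g t) f.
  move=> x y; rewrite !mem_cat => /orP[xu|/mapP[a At ->]] /orP[yu|/mapP[b bt ->]].
  - by rewrite !fu.
  - by rewrite (fu x xu) (ft b bt) (gh _ _ xu bt).1.
  - by rewrite (fu y yu) (ft a At) (gh _ _ yu At).2.
  - by rewrite (ft a At) (ft b bt) !aut_mono.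
exists n => [b bu|a At]; first by rewrite nf ?fu // mem_cat bu.
by rewrite /= nf ?ft // mem_cat map_f ?orbT.
Qed.

(** The measure axiom for the inclusion of s into t and the embedding of s into
    u by sigma: modulo G, a point of the fibre product is the inclusion of u
    together with an embedding of t that agrees with sigma on s, and the latter
    is unique up to the fixer of u. *)
Lemma relnu_coset_sum s t u (sigma : aut Omega) r (w : 'I_r -> aut Omega) :
  {subset s <= t} -> {subset map sigma s <= u} ->
  class_reps (agree s sigma) (moves_by u t) w ->
  (\sum_j relnu u (map (w j) t) = relnu s t)%R.
Proof.
move=> st su [wS wU].
have [|alpha [alphaE _]] := @emb_corestr _ _ _ (subposet_emb s) t.
  by move=> a; rewrite codom_subposet_emb => /st.
have [|beta [betaE _]] := @emb_corestr _ _ _ (emb_comp (aut_emb sigma) (subposet_emb s)) u.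
  by move=> _ /codomP[[a As] ->]; apply: su; exact: map_f.
pose zp j : emb_action Omega (subposet u) * emb_action Omega (subposet t) :=
  (subposet_emb u, emb_comp (aut_emb (w j)) (subposet_emb t)).
have zpE j : emb_restr Omega beta (zp j).1 = emb_restr Omega alpha (zp j).2.
  apply: emb_eq => -[a As] /=; rewrite [LHS]betaE alphaE /=.
  exact: wS.
pose z j : fiber_product (emb_restr Omega beta) (emb_restr Omega alpha) := exist _ _ (zpE j).
have -> : relnu s t = nu alpha.
  apply/esym/(relnuE (e := subposet_emb t)) => a.
    apply/codomP/idP => [[[b bs] ->]|As]; first by rewrite /= alphaE.
    by exists (SeqSub As : subposet s); rewrite /= alphaE.
  rewrite codom_subposet_emb mem_cat orbC.
  by case: (boolP (a \in t)) => //= /negP aNt; apply/esym/negP => /st.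
rewrite (@relnu_orbit_sum _ _ _ alpha beta _ z).
  apply: eq_bigr => j _; apply: relnu_mem => a /=; rewrite ?mem_cat.
    by rewrite codom_subposet_emb.
  rewrite codom_subposet_emb; congr (_ || _).
  apply/mapP/codomP => [[b bt ->]|[[b bt] ->]]; last by exists b.
  by exists (SeqSub bt : subposet t).
case=> -[e f] /= ef.
have [g gE] := generic_homogeneous gO (subposet_emb u) e.
have [h hE] := generic_homogeneous gO (subposet_emb t) f.
have gE' b (bu : b \in u) : g b = e (SeqSub bu) by exact: (gE (SeqSub bu)).
have hE' b (bt : b \in t) : h b = f (SeqSub bt) by exact: (hE (SeqSub bt)).
have [|j [[n nu_ nw] jU]] := wU (g^-1 * h)%g.
  move=> a As /=; rewrite (hE' _ (st _ As)).
  have /(congr1 (fun v : embedding (subposet s) Omega => v (SeqSub As))) /= := ef.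
  have -> : alpha (SeqSub As) = SeqSub (st _ As) by apply: val_inj; rewrite alphaE.
  move=> <-; rewrite -[e _]gE aut_funK /=.
  by rewrite [val _]betaE.
exists j; split=> [|j' [n' n'E]].
  exists (g * n)%g; apply: sval_eq => /=; congr pair; apply: emb_eq => -[b bs] /=.
    by rewrite nu_ // gE'.
  by have /= -> := nw b bs; rewrite aut_invK hE'.
have {}n'E := congr1 sval n'E.
apply: jU; exists (g^-1 * n')%g => b bs /=.
  have := congr1 (fun v : embedding (subposet u) Omega * embedding (subposet t) Omega =>
    v.1 (SeqSub bs)) n'E.
  by rewrite /= -gE' => ->; rewrite aut_funK.
have := congr1 (fun v : embedding (subposet u) Omega * embedding (subposet t) Omega =>
  v.2 (SeqSub bs)) n'E.
by rewrite /= -hE' => ->.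
Qed.

End RelativeValue.

(** * Extending a measure from finite posets to all transitive G-sets *)

(** Representatives for a finer relation R', from representatives for R and,
    inside each class of R, for R'. *)
Lemma class_reps_sigma (T : Type) (S : T -> Prop) (R R' : T -> T -> Prop) (I : Type)
    (J : I -> Type) (sigma : I -> T) (w : forall i, J i -> T) :
  (forall i g, R (sigma i) g -> S g) ->
  (forall i g h, R (sigma i) g -> R' g h -> R (sigma i) h) ->
  class_reps S R sigma -> (forall i, class_reps (R (sigma i)) R' (w i)) ->
  class_reps S R' (fun ij : {i : I & J i} => w (tag ij) (tagged ij)).
Proof.
move=> RS RR' [_ sU] wP; split=> [[i j]|g Sg] /=.
  by apply: (RS i); have [] := wP i.
have [i [ig iU]] := sU _ Sg; have [wS /(_ _ ig)[j [jg jU]]] := wP i.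
exists (Tagged J j); split=> // -[i' j'] /= jg'.
have ii' : i = i' by apply: iU; apply: RR' jg'; have [] := wP i'.
by subst i'; rewrite (jU j').
Qed.

Section Stabilizers.
Context (d : Order.disp_t) (Omega : porderType d).
Local Open Scope group_scope.

Lemma stabilizer_subgroup (X : gaction Omega) (x : X) : is_subgroup (stabilizer x).
Proof.
split; first exact: gact1.
  by move=> g h gx hx; rewrite /stabilizer /= gactM hx.
by move=> g gx; rewrite /stabilizer /= -[in LHS]gx -gactM mulVg gact1.
Qed.

Lemma fixes_subgroup (s : seq Omega) : is_subgroup (fixes s).
Proof.
split=> [a //|g h gs hs a As /=|g gs a As /=]; first by rewrite hs // gs.
by rewrite -[in LHS](gs a As) aut_funK.
Qed.

Lemma same_coset_fixes (s : seq Omega) : same_coset (fixes s) = agree s.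
Proof.
apply/funext => g; apply/funext => h; apply/propext; split=> gh a As.
  by rewrite -[in LHS](gh a As) /= aut_invK.
by rewrite /= -gh // aut_funK.
Qed.

Lemma double_coset_fixes (u t : seq Omega) :
  double_coset (fixes u) (fixes t) = moves_by u t.
Proof.
apply/funext => g; apply/funext => h; apply/propext; split.
  by move=> [n [m [nu_ mt <-]]]; exists n => // a At; rewrite /= mt.
move=> [n nu_ nt]; exists n, ((n * g)^-1 * h); split=> //; last by rewrite mulVKg.
by move=> a At; rewrite [LHS]/= -nt // [LHS](aut_funK (n * g)).
Qed.

Lemma stabilizer_normalizes (X : gaction Omega) (sX : smooth X)
    (gO : generic_poset Omega) (x : X) :
  normalizes (stabilizer x) (fixes (supp sX x)).
Proof.
move=> g n gx nx a; rewrite (supp_stab gO sX gx) => /mapP[b bx ->] /=.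
by rewrite aut_funK nx.
Qed.

Lemma fixes_stabilizer (X : gaction Omega) (sX : smooth X) (x : X) g :
  fixes (supp sX x) g -> stabilizer x g.
Proof. by move=> gx; apply: (@supp_supports _ _ _ sX x). Qed.

Lemma tgset_connected (X : tgset Omega) (x y : X) : exists g, gact g x = y.
Proof.
have [z zP] := tgset_trans X; have [g gx] := zP x; have [h hy] := zP y.
by exists (h * g^-1); rewrite -gx -gactM mulgVK.
Qed.

Lemma supp_fiber_product (gO : generic_poset Omega) (X' Y X : gaction Omega)
    (h : gmap X' X) (f : gmap Y X) (sX' : smooth X') (sY : smooth Y)
    (w : fiber_product h f) :
  supp (fiber_product_smooth (h := h) (f := f) sX' sY) w =i
    supp sX' (sval w).1 ++ supp sY (sval w).2.
Proof.
move=> a; apply/idP/idP.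
  apply: (supp_min gO) => g gw; apply: sval_eq => /=; rewrite [RHS]surjective_pairing.
  congr pair; apply: fixes_stabilizer => b bs; apply: gw; rewrite mem_cat; apply/orP;
    [left|right]; exact: bs.
have fixw g : fixes (supp (fiber_product_smooth (h := h) (f := f) sX' sY) w) g ->
    gact g (sval w).1 = (sval w).1 /\ gact g (sval w).2 = (sval w).2.
  by move=> /fixes_stabilizer /(congr1 sval) /= gw; split; rewrite -[in RHS]gw.
rewrite mem_cat => /orP[]; apply: (supp_min gO) => g /fixw; by case.
Qed.
End Stabilizers.

Section Extension.
Context (d : Order.disp_t) (Omega : porderType d) (gO : generic_poset Omega).
Context (k : fieldType) (k_char0 : [pchar k]%R =i pred0).
Context (nu : prule d k) (nuP : is_pmeasure nu).
Local Notation relnu := (@relnu d Omega k nu).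
Local Notation deg := (deg gO).

Lemma deg_neq0 (X : gaction Omega) (sX : smooth X) (x : X) : ((deg sX x)%:R != 0 :> k)%R.
Proof. by rewrite ((pcharf0P k).1 k_char0) -lt0n deg_gt0. Qed.

Lemma relnu_chain s t u : {subset s <= t} -> {subset t <= u} ->
  (relnu s t * relnu t u = relnu s u)%R.
Proof.
move=> st tu.
have stE : s ++ t =i t.
  by move=> a; rewrite mem_cat; case: (boolP (a \in s)) => //= /st ->.
have tuE : t ++ u =i u.
  by move=> a; rewrite mem_cat; case: (boolP (a \in t)) => //= /tu ->.
rewrite -(relnu_mem nuP (s := t) (t := u) (s' := s ++ t) (t' := u)) //; last first.
  by move=> a; rewrite !mem_cat -orbA; case: (boolP (a \in s)) => //= /st ->.
rewrite relnu_trans //; apply: relnu_mem => // a.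
by rewrite !(mem_cat _ s) tuE.
Qed.

(** If x = f y, the coverings Omega^[supp y] -> Y and Omega^[supp x] -> X have
    deg y and deg x sheets, and their square with f commutes; this is the only
    value compatible with multiplicativity. *)
Definition point_value (Y X : gaction Omega) (sY : smooth Y) (sX : smooth X) (f : gmap Y X)
    (y : Y) : k :=
  (relnu (supp sX (f y)) (supp sY y) * (deg sX (f y))%:R / (deg sY y)%:R)%R.

Lemma point_value_act (Y X : gaction Omega) (sY : smooth Y) (sX : smooth X) (f : gmap Y X) y g :
  point_value sY sX f (gact g y) = point_value sY sX f y.
Proof.
rewrite /point_value gmap_equiv !deg_act; congr (_ * _ / _)%R.
apply: (relnu_aut nuP (g := g)) => a; first exact: (supp_act gO).
by rewrite map_cat !mem_cat !(supp_act gO).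
Qed.

Definition extension : grule Omega k := fun Y X f =>
  point_value (@tgset_smooth _ _ Y) (@tgset_smooth _ _ X) f (projT1 (cid (tgset_trans Y))).

Lemma extensionE (Y X : tgset Omega) (f : gmap Y X) (y : Y) :
  extension f = point_value (@tgset_smooth _ _ Y) (@tgset_smooth _ _ X) f y.
Proof.
rewrite /extension; case: cid => y0 /= _.
by have [g <-] := tgset_connected y0 y; rewrite point_value_act.
Qed.

(** A bijection preserves stabilizers, hence supports and degrees. *)
Lemma extension_iso (Y X : tgset Omega) (f : gmap Y X) : bijective f -> extension f = 1%R.
Proof.
move=> /bij_inj f_inj; have [y _] := tgset_trans Y.
have stabE : stabilizer (f y) = stabilizer y.
  apply/seteqP; split=> g; rewrite /stabilizer /= -gmap_equiv; first exact: f_inj.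
  by move->.
rewrite (extensionE f y) /point_value (deg_stab gO _ (@tgset_smooth _ _ Y) stabE).
rewrite mulfK ?deg_neq0 // relnu_self // => a.
by rewrite (supp_stab_eq gO _ (@tgset_smooth _ _ Y) stabE).
Qed.

Lemma extension_comp (Z Y X : tgset Omega) (g : gmap Y X) (f : gmap Z Y) :
  extension (gmap_comp g f) = (extension g * extension f)%R.
Proof.
have [z _] := tgset_trans Z.
rewrite (extensionE _ z) (extensionE f z) (extensionE g (f z)) /point_value /=.
rewrite -(@relnu_chain _ (supp (@tgset_smooth _ _ Y) (f z))); try exact: (supp_gmap gO).
have := deg_neq0 (@tgset_smooth _ _ Y) (f z); set a := (_%:R)%R => a0.
rewrite -!mulrA; congr (_ * _)%R; rewrite mulrCA; congr (_ * _)%R.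
by rewrite [in RHS]mulrCA mulKf.
Qed.

(** An embedding e has the same stabilizer as its image pointwise, so its degree
    is 1 and no correction factor appears. *)
Lemma extension_restr (P Q : finPOrderType d) (alpha : embedding P Q) :
  prule_of_grule gO extension alpha = nu alpha.
Proof.
have [e _] := emb_action_trans Q gO.
rewrite /prule_of_grule (extensionE (Y := emb_tgset Q gO) (X := emb_tgset P gO) _ e) /point_value.
rewrite (deg_stab gO _ (@emb_action_smooth d Omega Q) (erefl (stabilizer e))).
set x := emb_restr _ _ _.
rewrite (deg_stab gO _ (@emb_action_smooth d Omega P) (erefl (stabilizer x))) !deg_emb.
rewrite mulr1 divr1; apply/esym; apply: (relnuE nuP (e := e)) => a.
  by rewrite (supp_stab_eq gO _ (@emb_action_smooth d Omega P) (erefl (stabilizer x))) (supp_emb gO).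
rewrite mem_cat (supp_stab_eq gO _ (@emb_action_smooth d Omega P) (erefl (stabilizer x))).
rewrite (supp_stab_eq gO _ (@emb_action_smooth d Omega Q) (erefl (stabilizer e))) !(supp_emb gO).
case: (boolP (a \in codom e)) => [_|aNe]; first by rewrite orbT.
by rewrite orbF; apply/esym/negP => /codomP[p ap]; case/negP: aNe; rewrite ap /= codom_f.
Qed.


(** Put A, B, C for the supports of x = f y, x' and y. The sum of relnu B (g C)
    over the double cosets of the fixers of B and C in Stab(x) is computed in
    two ways: coset by coset of the fixer of A, where it is deg x times
    relnu A C, and by double cosets of Stab(x') and Stab(y), which are the
    orbits on the fibre product. *)
Lemma extension_orbits (X' Y X : tgset Omega) (f : gmap Y X) (h : gmap X' X) r
    (z : 'I_r -> fiber_product h f) : (forall w, exists! i, in_orbit (z i) w) ->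
  extension f = (\sum_(i < r) extension (fiber_orbit_proj (z i)))%R.
Proof.
move=> zU.
pose sY := @tgset_smooth _ _ Y; pose sX := @tgset_smooth _ _ X.
pose sX' := @tgset_smooth _ _ X'.
pose sF := fiber_product_smooth (h := h) (f := f) sX' sY.
have [y _] := tgset_trans Y; have [x'0 _] := tgset_trans X'.
have [x' hx'] : exists x', h x' = f y.
  have [g0 g0x] := tgset_connected (h x'0) (f y).
  by exists (gact g0 x'0); rewrite gmap_equiv.
pose x := f y; pose A := supp sX x; pose B := supp sX' x'; pose C := supp sY y.
have AB : {subset A <= B} by rewrite /A /x -hx'; exact: (supp_gmap gO).
have AC : {subset A <= C} by exact: (supp_gmap gO).
pose H := stabilizer x'; pose U := stabilizer y; pose V := stabilizer x.
have HV g : H g -> V g by move=> gx'; rewrite /V /stabilizer /= /x -hx' -gmap_equiv gx'.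
have UV g : U g -> V g by move=> gy; rewrite /V /stabilizer /= /x -gmap_equiv gy.
have sV := stabilizer_subgroup x.
(* Each orbit meets the fibre over x', in a point (x', v y) with v fixing x. *)
have ptP g : V g -> h x' = f (gact g y) by move=> gx; rewrite gmap_equiv hx'.
pose pt g (Vg : V g) : fiber_product h f :=
  exist (fun p => h p.1 = f p.2) (x', gact g y) (ptP g Vg).
have vP i : exists g, exists Vg : V g, in_orbit (z i) (pt g Vg).
  have [g1 g1x] := tgset_connected (sval (z i)).1 x'.
  have [g g1y] := tgset_connected y (gact g1 (sval (z i)).2).
  have Vg : V g.
    by rewrite /V /stabilizer /= /x -gmap_equiv g1y gmap_equiv -(svalP (z i)) -gmap_equiv g1x.
  by exists g, Vg, g1; apply: sval_eq; rewrite /= g1x g1y.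
have [v vE] := choice vP.
have Vv i : V (v i) by have [] := vE i.
have zv i : in_orbit (z i) (pt (v i) (Vv i)).
  by have [Vg] := vE i; rewrite (Prop_irrelevance (Vv i) Vg).
pose o i := pt (v i) (Vv i).
have v_reps : class_reps V (double_coset H U) v.
  split=> // g Vg; have ptE i : in_orbit (z i) (pt g Vg) <-> double_coset H U (v i) g.
    have [k1 k1z] := zv i; split=> [[k2 k2z]|[a [b [Ha Ub abg]]]].
      have : gact (k2 * k1^-1)%g (pt (v i) (Vv i)) = pt g Vg.
        by rewrite -k1z -gactM mulgVK k2z.
      set a := (k2 * _)%g => /(congr1 sval) /= [ax' ay].
      exists a, ((a * v i)^-1 * g)%g; split=> //; last by rewrite mulVKg.
      by rewrite /U /stabilizer /= gactM -ay -(gactM a (v i)) -gactM mulVg gact1.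
    exists (a * k1)%g; rewrite gactM k1z; apply: sval_eq => /=; congr pair => //.
    by rewrite -abg !gactM Ub.
  have [i [iz iU]] := zU (pt g Vg); exists i; split=> [|j /ptE]; first exact/ptE.
  exact: iU.
have [p p_reps] := deg_cosets gO sX' x'; have [q q_reps] := deg_cosets gO sY y.
have [sigma sigma_reps] := deg_cosets gO sX x.
have [m mP] := choice (fun l => exists_moves_by_reps gO (agree A (sigma l)) B C).
pose w l := projT1 (cid (mP l)).
have w_reps l : class_reps (agree A (sigma l)) (moves_by B C) (w l) := projT2 (cid (mP l)).
have tauP i := deg_cosets gO sF (o i).
pose tau i := projT1 (cid (tauP i)).
have tau_reps i : coset_reps sF (o i) (tau i) := projT2 (cid (tauP i)).
pose F (g : aut Omega) := relnu B (map g C).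
have sums : (\sum_(j : {l : 'I_(deg sX x) & 'I_(m l)}) F (w (tag j) (tagged j)) =
    (deg sX x)%:R * relnu A C)%R.
  rewrite -(sig_big_dep predT (fun _ => predT) (fun l j => F (w l j))) /=.
  rewrite mulr_natl -[in RHS](card_ord (deg sX x)) -sumr_const; apply: eq_bigr => l _.
  apply: (relnu_coset_sum gO nuP AC _ (w_reps l)) => _ /mapP[a aA ->]; apply: AB.
  have [sigmaV _] := sigma_reps.
  by rewrite (supp_stab gO sX (sigmaV l)) map_f.
have VHU a g b : H a -> V g -> U b -> V (a * g * b)%g.
  have [_ VM _] := sV; move=> Ha Vg Ub.
  by apply: (VM); [apply: (VM) => //; exact: HV|exact: UV].
have p_reps' : class_reps H (same_coset (fixes B)) p by rewrite same_coset_fixes.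
have q_reps' : class_reps U (same_coset (fixes C)) q by rewrite same_coset_fixes.
have w_reps' : class_reps V (double_coset (fixes B) (fixes C))
    (fun j : {l : 'I_(deg sX x) & 'I_(m l)} => w (tag j) (tagged j)).
  rewrite double_coset_fixes; apply: (class_reps_sigma (R := agree A)) w_reps => //.
    move=> l g lg; rewrite /V /stabilizer /= -(agree_gact lg).
    by have [sigmaV _] := sigma_reps; exact: sigmaV.
  move=> l g g' lg [n nB ng'] a aA; rewrite -ng' /=; last exact: AC.
  rewrite -lg // nB //; apply: AB; have [sigmaV _] := sigma_reps.
  by rewrite (supp_stab gO sX (sigmaV l)) map_f.
have suppo i : supp sF (o i) =i B ++ map (v i) C.
  by move=> a; rewrite (supp_fiber_product gO) !mem_cat /= (supp_act gO).
have tau_reps' i : class_reps (fun g => H g /\ U ((v i)^-1 * g * v i)%g)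
    (fun g g' => same_coset (fixes B) g g' /\
       fixes C ((v i)^-1 * (g^-1 * g') * v i)%g) (tau i).
  have := tau_reps i; rewrite /coset_reps.
  have -> : stabilizer (o i) = (fun g => H g /\ U ((v i)^-1 * g * v i)%g).
    apply/funext => g; apply/propext; split=> [/(congr1 sval) /= [gx' gy]|[gx' gy]].
      by split=> //; rewrite /U /stabilizer /= !gactM gy -gactM mulVg gact1.
    apply: sval_eq => /=; congr pair => //; rewrite -[in RHS](gy).
    by rewrite -!gactM !mulgA mulgV mul1g.
  congr class_reps; apply/funext => g; apply/funext => g'; apply/propext.
  rewrite same_coset_fixes; split=> [gg'|[gB gC] a].
    split=> [a aB|a aC]; first by apply: gg'; rewrite suppo mem_cat aB.
    have /= gg'a := gg' (v i a); rewrite /= -gg'a ?aut_funK //.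
    by rewrite suppo mem_cat map_f ?orbT.
  rewrite suppo mem_cat => /orP[/gB //|/mapP[c cC ->]].
  have /= := gC c cC => /(congr1 (fun b => g (v i b))).
  by rewrite !aut_invK.
have F_inv g g' : double_coset H U g g' -> F g = F g'.
  move=> [a [b [Ha Ub <-]]]; apply/esym/(relnu_aut nuP (g := a)) => c.
    exact: (supp_stab gO sX' Ha).
  rewrite map_cat !mem_cat (supp_stab gO sX' Ha); congr (_ || _).
  have -> : map (a * g * b)%g C = map a (map g (map b C)) by rewrite -!map_comp.
  apply: eq_mem_map => {}c; apply: eq_mem_map => {}c.
  by rewrite -(supp_stab gO sY Ub).
have degs i : (#|'I_(deg sF (o i))|%:R != 0 :> k)%R by rewrite card_ord deg_neq0.
have := double_coset_sum (stabilizer_subgroup _) (fixes_subgroup _)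
  (stabilizer_subgroup _) (fixes_subgroup _) (stabilizer_normalizes gO (x := x'))
  (stabilizer_normalizes gO (x := y)) (@fixes_stabilizer _ _ _ sX' x')
  (@fixes_stabilizer _ _ _ sY y) VHU p_reps' q_reps' w_reps' v_reps tau_reps' degs F_inv.
rewrite {}sums => sumE.
have degx := deg_neq0 sX x; have degy := deg_neq0 sY y.
transitivity ((deg sX x)%:R * relnu A C / (deg sY y)%:R)%R.
  by rewrite (extensionE f y) /point_value [in RHS](mulrC _%:R%R).
rewrite sumE mulr_suml; apply: eq_bigr => i _.
pose oi : fiber_orbit (z i) := exist (in_orbit (z i)) (o i) (zv i).
have oiE : stabilizer oi = stabilizer (o i).
  by apply/seteqP; split=> [g /(congr1 sval)|g gw] //; apply: sval_eq.
rewrite (extensionE _ oi) /point_value (deg_stab gO _ sF oiE).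
rewrite (_ : relnu _ _ = F (v i)); last first.
  apply: (relnu_mem nuP) => // a.
  by rewrite !(mem_cat _ B) (supp_stab_eq gO _ sF oiE) suppo mem_cat orbA orbb.
by rewrite !card_ord natrM mulrA (mulrAC _ _ _^-1)%R mulfK.
Qed.

Lemma extension_gmeasure : is_gmeasure extension.
Proof.
split; [exact: extension_iso|exact: extension_comp|exact: extension_orbits].
Qed.
End Extension.

(** * Uniqueness of the extension *)

Section Uniqueness.
Context (d : Order.disp_t) (Omega : porderType d) (gO : generic_poset Omega).
Context (k : fieldType) (k_char0 : [pchar k]%R =i pred0).
Local Open Scope group_scope.

Section Cover.
Context (Y : tgset Omega) (y : Y).
Local Notation sY := (@tgset_smooth _ _ Y).
Local Notation C := (supp sY y).
Local Notation W := (emb_tgset (subposet C) gO).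

(** Well defined because the fixer of supp y fixes y. *)
Lemma exists_cover : exists pi : gmap W Y, pi (subposet_emb C : W) = y.
Proof.
have WE (e : W) : exists g, gact g (subposet_emb C : W) = e := tgset_connected _ e.
have piP (e : W) : exists u, forall g, gact g (subposet_emb C : W) = e -> gact g y = u.
  have [g ge] := WE e; exists (gact g y) => h he.
  apply: (@agree_gact _ _ _ sY) => a aC.
  have := congr1 (fun w : embedding (subposet C) Omega => w (SeqSub aC)) (etrans he (esym ge)).
  by [].
have [pi piE] := choice piP.
have pi_equiv g e : pi (gact g e) = gact g (pi e).
  have [h he] := WE e; rewrite -(piE _ _ he) -gactM; apply/esym/piE.
  by rewrite gactM he.
by exists (GMap pi_equiv); rewrite /= -(piE _ 1) gact1.
Qed.

(** Pull pi back along itself. A point (e1, e2) of the fibre product is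
    (g e0, g p e0) for a unique coset of p, so there are deg y orbits; each of
    them projects bijectively, since p permutes supp y. *)
Lemma cover_value (mu : grule Omega k) (pi : gmap W Y) :
  is_gmeasure mu -> pi (subposet_emb C : W) = y -> mu W Y pi = ((deg gO sY y)%:R)%R.
Proof.
move=> [mu_iso _ mu_orb] piy; have [p [pS pU]] := deg_cosets gO sY y.
pose e0 : W := subposet_emb C.
have pC i a : a \in C -> p i a \in C.
  by move=> aC; rewrite (supp_stab gO sY (pS i)) map_f.
have piz i : pi e0 = pi (gact (p i) e0).
  by rewrite gmap_equiv piy; apply/esym/pS.
pose z i : fiber_product pi pi := exist (fun w => pi w.1 = pi w.2) (e0, gact (p i) e0) (piz i).
have zU w : exists! i, in_orbit (z i) w.
  case: w => -[e1 e2] /= e12.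
  have [g1 ge1] := tgset_connected e0 e1; have [g2 ge2] := tgset_connected e0 e2.
  have [|i [ip iU]] := pU (g1^-1 * g2).
    rewrite /stabilizer /= gactM -{1}piy -gmap_equiv ge2 -e12 -ge1 gmap_equiv piy.
    by rewrite -gactM mulVg gact1.
  exists i; split=> [|j [g /(congr1 sval) /= [/esym gj1 gj2]]].
    exists g1; apply: sval_eq => /=; congr pair => //; rewrite -ge2.
    by apply: emb_eq => -[a aC] /=; rewrite ip //= aut_invK.
  apply: iU => a aC.
  have gg1 b (bC : b \in C) : g b = g1 b.
    exact: (congr1 (fun w : embedding (subposet C) Omega => w (SeqSub bC))
      (esym (etrans ge1 gj1))).
  have g2a : g (p j a) = g2 a.
    exact: (congr1 (fun w : embedding (subposet C) Omega => w (SeqSub aC))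
      (etrans gj2 (esym ge2))).
  by rewrite /= -g2a gg1 ?pC // aut_funK.
rewrite (mu_orb _ _ _ pi pi _ z zU) (eq_bigr (fun=> 1%R)) ?sumr_const ?card_ord // => i _.
apply: mu_iso; apply: inj_surj_bij => [[v [g gv]] [v' [g' gv']]|e].
  move=> /= vv'; apply: sval_eq => /=; rewrite -gv -gv'; apply: sval_eq => /=.
  have {}vv' : gact g e0 = gact g' e0 by move: vv'; rewrite -gv -gv'.
  congr pair => //.
  have gg' a (aC : a \in C) : g a = g' a.
    exact: (congr1 (fun w : embedding (subposet C) Omega => w (SeqSub aC)) vv').
  by apply: emb_eq => -[a aC] /=; rewrite gg' // pC.
have [g ge] := tgset_connected e0 e.
have gz : in_orbit (z i) (gact g (z i)) by exists g.
by exists (exist _ _ gz).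
Qed.
End Cover.

Lemma gmeasure_unique (mu mu' : grule Omega k) : is_gmeasure mu -> is_gmeasure mu' ->
  prule_of_grule gO mu = prule_of_grule gO mu' -> mu = mu'.
Proof.
move=> muP muP' mumu'.
apply: functional_extensionality_dep => Y; apply: functional_extensionality_dep => X.
apply: functional_extensionality_dep => f; have [y _] := tgset_trans Y.
have [piY piYy] := exists_cover y; have [piX piXx] := exists_cover (f y).
have [|alpha [alphaE _]] := @emb_corestr _ _ _
    (subposet_emb (supp (@tgset_smooth _ _ X) (f y))) (supp (@tgset_smooth _ _ Y) y).
  by move=> a; rewrite codom_subposet_emb; exact: (supp_gmap gO).
have square : gmap_comp f piY =
    gmap_comp piX (emb_restr Omega alpha : gmap (emb_tgset _ gO) (emb_tgset _ gO)).
  apply: gmap_eq => e; have [g <-] := tgset_connected (subposet_emb _ : emb_tgset _ gO) e.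
  rewrite /= emb_restr_equiv !gmap_equiv piYy -{1}piXx; congr (gact g (piX _)).
  by apply: emb_eq => a; rewrite /= alphaE.
have muE (rho : grule Omega k) : is_gmeasure rho ->
    (rho _ _ f * (deg gO (@tgset_smooth _ _ Y) y)%:R =
     (deg gO (@tgset_smooth _ _ X) (f y))%:R * prule_of_grule gO rho alpha)%R.
  move=> rhoP; have [_ rho_comp _] := rhoP.
  rewrite -(cover_value rhoP piYy) -(cover_value rhoP piXx).
  by rewrite -rho_comp square rho_comp.
have := muE _ muP; rewrite mumu' -(muE _ muP') => /mulIf; apply.
exact: deg_neq0.
Qed.
End Uniqueness.

Unset Implicit Arguments.

Theorem proposition9p4 (d : Order.disp_t) (Omega : porderType d)
    (gO : generic_poset Omega) (k : fieldType) (k_char0 : [pchar k]%R =i pred0) :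
  (forall mu : grule Omega k,
     is_gmeasure mu -> is_pmeasure (prule_of_grule gO mu)) /\
  (forall nu : prule d k, is_pmeasure nu ->
     exists! mu : grule Omega k, is_gmeasure mu /\ prule_of_grule gO mu = nu).
Proof.
split=> [mu|nu nuP]; first exact: restriction_pmeasure.
have extK : prule_of_grule gO (extension gO nu) = nu.
  apply: functional_extensionality_dep => P; apply: functional_extensionality_dep => Q.
  by apply: funext => alpha; exact: extension_restr.
have extP := extension_gmeasure gO k_char0 nuP.
exists (extension gO nu); split=> // mu [muP muE].
by apply: (gmeasure_unique k_char0 extP muP); rewrite extK muE.
Qed.
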